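(* (Shape theorem.) Let $\{\omega_x\}_{x\in\mathbb Z^2}$ be independent rate $1$ exponentially distributed random variables. Given $\varepsilon>0$, there exists an almost surely finite random variable $T$ such that $$t(1-\varepsilon)\mathcal A\ \subset\ A_t\ \subset\ t(1+\varepsilon)\mathcal A\qquad\text{for all }t\ge T.$$
   Context: For $x\le y$ (coordinatewise) in $\mathbb Z^2$, $G_{x,y}=\max\sum_{k=0}^{|y-x|_1}\omega_{x_k}$, the maximum being over up-right lattice paths from $x_0=x$ to $y$ with increments in $\{(1,0),(0,1)\}$. For real $t\ge0$, $A_t=\{\zeta\in\mathbb R_{\ge0}^2:G_{0,\lfloor\zeta\rfloor}\le t\}$ with coordinatewise integer parts, and $\mathcal A=\{\zeta\in\mathbb R_{\ge0}^2:g_{\rm pp}(\zeta)\le1\}$, where $g_{\rm pp}(\zeta)=(\sqrt{\zeta_1}+\sqrt{\zeta_2})^2$ is the a.s. limit of $N^{-1}G_{0,\lfloor N\zeta\rfloor}$.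
   Formalization: The lower inclusion t(1-ε)𝒜 ⊂ A_t is stated only for ε ≤ 1, since for ε > 1 and t > 0 the set t(1-ε)𝒜 contains points with negative coordinates and the inclusion fails; the upper inclusion is stated for every ε > 0. *)

(* Defs.v *)
From mathcomp Require Export all_boot all_order all_algebra.
From mathcomp Require Export all_classical all_reals all_analysis.
From mathcomp Require Export measurable_realfun.

Set Implicit Arguments.
Unset Strict Implicit.
Unset Printing Implicit Defensive.

Import Order.TTheory GRing.Theory Num.Theory.

Local Open Scope classical_set_scope.
Local Open Scope ring_scope.

(* Mutual independence: the product rule over every finite subfamily, each
   finite set of indices being listed without repetition. *)
Definition mutually_independent (d d' : measure_display) (Omega : measurableType d)
    (E : measurableType d') (R : realType) (P : probability Omega R)
    (I : choiceType) (X : I -> {RV P >-> E}) : Prop :=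
  forall (s : seq I) (B : I -> set E), uniq s ->
    (forall i, i \in s -> measurable (B i)) ->
    P [set w | forall i, i \in s -> X i w \in B i] =
      (\prod_(i <- s) P (X i @^-1` B i))%E.

Definition exponentially_distributed (d : measure_display)
    (Omega : measurableType d) (R : realType) (P : probability Omega R)
    (rate : R) (X : {RV P >-> R}) : Prop :=
  forall B : set R, measurable B -> distribution P X B = exponential_prob rate B.

Definition up_right : rel (int * int) := fun u v =>
  (v == (u.1 + 1, u.2)) || (v == (u.1, u.2 + 1)).

(* [p] lists the sites after [x], so the whole path is [x :: p]; an up-right
   path from [x] to [y] necessarily has |y - x|_1 steps. *)
Definition up_right_path (x y : int * int) (p : seq (int * int)) : bool :=
  path up_right x p && (last x p == y).

(* For [x <= y] coordinatewise the set of passage times is finite and nonempty,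
   so the supremum is a maximum; otherwise the value is a dummy 0. *)
Definition last_passage (R : realType) (w : int * int -> R)
    (x y : int * int) : R :=
  sup [set \sum_(z <- x :: p) w z | p in [set p | up_right_path x y p]].

Definition growing_set (R : realType) (w : int * int -> R) (t : R) :
    set (R * R) :=
  [set z | [/\ 0 <= z.1, 0 <= z.2 &
    last_passage w (0, 0) (Num.floor z.1, Num.floor z.2) <= t]].

Definition g_pp (R : realType) (z : R * R) : R :=
  (Num.sqrt z.1 + Num.sqrt z.2) ^+ 2.

Definition limit_shape (R : realType) : set (R * R) :=
  [set z | [/\ 0 <= z.1, 0 <= z.2 & g_pp z <= 1]].

Definition dilate (R : realType) (s : R) (A : set (R * R)) : set (R * R) :=
  [set (s * z.1, s * z.2) | z in A].

(* Main.v *)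
(* Multiply the weights on the horizontal and vertical axes by [u] and [v] with
   [1/u + 1/v = 1].  The corner map
   [(I, J, w) |-> (w + (I - J)^+, w + (J - I)^+, min(I, J))] preserves the law
   Exp(1/u) x Exp(1/v) x Exp(1) (Burke's property), so, sweeping the quadrant
   one corner at a time, the vertical increments of the modified last-passage
   time along every column are i.i.d. Exp(1/v), and Chernoff's bound
   concentrates the passage time to [(m, n)] around [m u + n v].

   The modification only increases passage times, and the minimum of
   [m u + n v] over such pairs is [(sqrt m + sqrt n)^2]: this is the upper
   bound.  Conversely, let [A] be the weight that a maximizing path collects on
   the axis along which it leaves the origin.  Raising the multiplier of that
   axis by [h] raises the passage time by at least [h A], whereas near the
   minimizer the growth rate only moves by O(h^2); hence [A] is negligible, and
   replacing the multipliers by 1 costs little.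

   Both bounds fail with exponentially small probability at the points
   [(k i, k j)], [i, j <= n].  Borel-Cantelli makes them hold for all large [k],
   and monotonicity of passage times, with [k] a small multiple of [t],
   interpolates between the grid points. *)
From HB Require Import structures.
Require Import Defs.
From mathcomp Require Import ring lra.

Set Implicit Arguments.
Unset Strict Implicit.
Unset Printing Implicit Defensive.

Import Order.TTheory GRing.Theory Num.Theory.

Local Open Scope classical_set_scope.
Local Open Scope ring_scope.

(** * Last-passage times as a recursion *)

Section LastPassageRecursion.
Variable R : realType.
Implicit Types a b : nat * nat -> R.

(** The dynamic-programming form of the passage time from the origin. Nesting a fixpoint on [j]
    inside the one on [i] makes the double recursion structural; column [0] is a plain sum because a
    single path reaches each of its sites. *)
Fixpoint lpp a (i : nat) : nat -> R :=
  match i with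
  | 0 => fun j => \sum_(l < j.+1) a (0, val l)%N
  | i'.+1 => fix col (j : nat) : R :=
      match j with
      | 0 => lpp a i' 0 + a (i, 0)%N
      | j'.+1 => a (i, j) + Num.max (lpp a i' j) (col j')
      end
  end.

Lemma lpp00 a : lpp a 0 0 = a (0, 0)%N.
Proof. by rewrite /= big_ord1. Qed.

Lemma lpp0S a j : lpp a 0 j.+1 = lpp a 0 j + a (0, j.+1)%N.
Proof. by rewrite /= big_ord_recr. Qed.

Lemma lppS0 a i : lpp a i.+1 0 = lpp a i 0 + a (i.+1, 0)%N.
Proof. by []. Qed.

Lemma lppSS a i j : lpp a i.+1 j.+1 =
  a (i.+1, j.+1) + Num.max (lpp a i j.+1) (lpp a i.+1 j).
Proof. by []. Qed.

#[local] Arguments lpp : simpl never.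

Lemma lppi0 a i : lpp a i 0 = a (0, 0)%N + \sum_(l < i) a (l.+1, 0)%N.
Proof.
elim: i => [|i IH]; first by rewrite lpp00 big_ord0 addr0.
by rewrite lppS0 IH big_ord_recr /= addrA.
Qed.

Lemma lpp0j a j : lpp a 0 j = a (0, 0)%N + \sum_(l < j) a (0, l.+1)%N.
Proof.
elim: j => [|j IH]; first by rewrite lpp00 big_ord0 addr0.
by rewrite lpp0S IH big_ord_recr /= addrA.
Qed.

Lemma lpp_stepl a i j : lpp a i j + a (i.+1, j) <= lpp a i.+1 j.
Proof. by case: j => [|j] //; rewrite lppSS addrC lerD2l le_max lexx. Qed.

Lemma lpp_stepr a i j : lpp a i j + a (i, j.+1) <= lpp a i j.+1.
Proof.
case: i => [|i]; first by rewrite lpp0S.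
by rewrite lppSS addrC lerD2l le_max lexx orbT.
Qed.

Lemma lpp_nondecreasing a i j i' j' : (forall z, 0 <= a z) ->
  (i <= i')%N -> (j <= j')%N -> lpp a i j <= lpp a i' j'.
Proof.
move=> a0 /subnK <- /subnK <-; elim: (i' - i)%N => [|p IH].
  rewrite add0n; elim: (j' - j)%N => [//|q IH]; apply: (le_trans IH).
  by rewrite addSn (le_trans _ (lpp_stepr _ _ _)) // lerDl.
by rewrite (le_trans IH) // addSn (le_trans _ (lpp_stepl _ _ _)) // lerDl.
Qed.

Lemma lpp_le a b i j : (forall z, a z <= b z) -> lpp a i j <= lpp b i j.
Proof.
move=> ab; elim: i j => [|i IHi] j; first by rewrite ler_sum.
elim: j => [|j IHj]; first by rewrite !lppS0 lerD.
by rewrite !lppSS lerD // ge_max !le_max IHi IHj orbT.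
Qed.

Definition site (z : nat * nat) : int * int := (Posz z.1, Posz z.2).

(** Induction on the path from its last step, which [lpp_stepl] or [lpp_stepr] absorbs. The
    existential also records that the path never leaves the quadrant. *)
Lemma up_right_path_lpp_ub (w : int * int -> R) p :
  path up_right (0, 0) p -> exists z, last (0, 0) p = site z /\
    \sum_(x <- (0, 0) :: p) w x <= lpp (w \o site) z.1 z.2.
Proof.
elim/last_ind: p => [_|p x IH].
  by exists (0, 0)%N; rewrite big_seq1 lpp00.
rewrite rcons_path => /andP[/IH[[i j] [lz le]]].
rewrite lz last_rcons -rcons_cons big_rcons /= => /orP[] /eqP ->.
- exists (i.+1, j); split; first by rewrite /site /= -addn1 PoszD.
  apply: le_trans (lpp_stepl _ _ _).
  by rewrite lerD //= /site /= -addn1 PoszD.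
- exists (i, j.+1); split; first by rewrite /site /= -addn1 PoszD.
  apply: le_trans (lpp_stepr _ _ _).
  by rewrite lerD //= /site /= -addn1 PoszD.
Qed.

Lemma up_right_path_lpp (w : int * int -> R) i j :
  exists2 p, up_right_path (0, 0) (site (i, j)) p &
    \sum_(x <- (0, 0) :: p) w x = lpp (w \o site) i j.
Proof.
have step (u v : nat * nat) p : up_right (site u) (site v) ->
    up_right_path (0, 0) (site u) p ->
    \sum_(x <- (0, 0) :: p) w x = lpp (w \o site) u.1 u.2 ->
    lpp (w \o site) v.1 v.2 = w (site v) + lpp (w \o site) u.1 u.2 ->
    exists2 q, up_right_path (0, 0) (site v) q &
      \sum_(x <- (0, 0) :: q) w x = lpp (w \o site) v.1 v.2.
  move=> uv /andP[pp /eqP lp] sp ->; exists (rcons p (site v)).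
    by rewrite /up_right_path rcons_path pp lp uv last_rcons eqxx.
  by rewrite -rcons_cons big_rcons /= sp addrC.
have ur1 k l : up_right (site (k, l)) (site (k.+1, l)).
  by rewrite /up_right /site /= -addn1 PoszD eqxx.
have ur2 k l : up_right (site (k, l)) (site (k, l.+1)).
  by rewrite /up_right /site /= -[l.+1]addn1 PoszD eqxx orbT.
elim: i j => [|i IHi] j.
  elim: j => [|j [p pp sp]].
    by exists [::]; rewrite ?/up_right_path /= ?eqxx // big_seq1 lpp00.
  by apply: (step _ (0, j.+1)%N _ (ur2 _ _) pp sp); rewrite lpp0S addrC.
elim: j => [|j [p pp sp]].
  have [p pp sp] := IHi 0%N.
  by apply: (step _ (i.+1, 0)%N _ (ur1 _ _) pp sp); rewrite lppS0 addrC.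
have [q qq sq] := IHi j.+1.
(* A maximizing path arrives from the predecessor with the larger passage time. *)
have [le1|le2] := leP (lpp (w \o site) i j.+1) (lpp (w \o site) i.+1 j).
- by apply: (step _ (i.+1, j.+1) _ (ur2 _ _) pp sp); rewrite lppSS max_r.
- by apply: (step _ (i.+1, j.+1) _ (ur1 _ _) qq sq); rewrite lppSS max_l // ltW.
Qed.

Lemma last_passage_lpp (w : int * int -> R) i j :
  last_passage w (0, 0) (site (i, j)) = lpp (w \o site) i j.
Proof.
have ub : ubound [set \sum_(z <- (0, 0) :: p) w z |
    p in [set p | up_right_path (0, 0) (site (i, j)) p]] (lpp (w \o site) i j).
  move=> x [q /andP[/up_right_path_lpp_ub - /(_ w)[[k l] [-> le]] /eqP[ek el]]] <-.
  by rewrite -ek -el.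
have [p pp sp] := up_right_path_lpp w i j.
apply/eqP; rewrite eq_le; apply/andP; split.
  by apply: ge_sup => //; exists (lpp (w \o site) i j), p.
by apply: ub_le_sup; [exists (lpp (w \o site) i j)|exists p].
Qed.

Definition axis_factor (u v : R) (z : nat * nat) : R :=
  match z with
  | (_.+1, 0) => u
  | (0, _.+1) => v
  | _ => 1
  end.

Definition scale_axes (u v : R) a z : R := axis_factor u v z * a z.

Lemma scale_axes11 a : scale_axes 1 1 a = a.
Proof. by apply/funext => -[[|i] [|j]]; rewrite /scale_axes mul1r. Qed.

Lemma lpp_scale_axes_ge a u v i j : (forall z, 0 <= a z) -> 1 <= u -> 1 <= v ->
  lpp a i j <= lpp (scale_axes u v a) i j.
Proof.
by move=> a0 u1 v1; apply: lpp_le => -[[|k] [|l]]; exact: ler_peMl.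
Qed.

(* [A] is the total weight that a maximizing path collects on the axis along
   which it leaves the origin. *)
Lemma lpp_scale_axes_subgradient a u v i j : (forall z, 0 <= a z) ->
  exists2 A, 0 <= A &
    (forall u' v', lpp (scale_axes u v a) i j + (u' - u) * A <=
       lpp (scale_axes u' v' a) i j) \/
    (forall u' v', lpp (scale_axes u v a) i j + (v' - v) * A <=
       lpp (scale_axes u' v' a) i j).
Proof.
move=> a0; elim: i j => [|i IHi] j.
  elim: j => [|j [A A0 IH]].
    by exists 0 => //; left => u' v'; rewrite !lpp00 mulr0 addr0.
  exists (\sum_(l < j.+1) a (0, l.+1)%N); first by rewrite sumr_ge0.
  right => u' v'; rewrite !lpp0j /= -!mulr_sumr -addrA -mulrDl.
  by rewrite [v + _]addrC subrK.
elim: j => [|j [A A0 IHj]].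
  exists (\sum_(l < i.+1) a (l.+1, 0)%N); first by rewrite sumr_ge0.
  left => u' v'; rewrite !lppi0 /= -!mulr_sumr -addrA -mulrDl.
  by rewrite [u + _]addrC subrK.
have [B B0 IHi'] := IHi j.+1.
set b := scale_axes u v a in IHj IHi' *.
(* A maximizing path goes through the better predecessor, and the new interior weight has factor 1
   under all multipliers; hence the subgradient of that predecessor is inherited. *)
have [le1|/ltW le2] := leP (lpp b i j.+1) (lpp b i.+1 j).
- exists A => //; case: IHj => IH; [left|right] => u' v';
    rewrite !lppSS max_r // /b [scale_axes _ _ _ _]/= [scale_axes _ _ _ (_.+1, _)]/=;
    by rewrite -addrA lerD2l (le_trans (IH u' v')) // le_max lexx orbT.
- exists B => //; case: IHi' => IH; [left|right] => u' v';
    rewrite !lppSS max_l // /b [scale_axes _ _ _ _]/= [scale_axes _ _ _ (_.+1, _)]/=;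
    by rewrite -addrA lerD2l (le_trans (IH u' v')) // le_max lexx.
Qed.

End LastPassageRecursion.

Arguments lpp : simpl never.

(** * Sweeping by corner flips *)

Section CornerFlips.
Variable R : realType.
Implicit Types a b : nat * nat -> R.

(** [p] and [q] hold the horizontal and vertical increments entering a corner, [r] the weight of the
    corner. The outgoing increments overwrite the entering ones, and writing the minimum into [r]
    makes the map preserve the joint law. *)
Definition corner_flip (I : eqType) (p q r : I) (a : I -> R) : I -> R :=
  fun z =>
  if z == p then a r + Num.max (a p - a q) 0
  else if z == q then a r + Num.max (a q - a p) 0
  else if z == r then Num.min (a p) (a q) else a z.

(* Column [i] is crossed upwards: site [(i, 0)%N] stores the current horizontal
   increment of [lpp], and the sites [(0, l)] store the vertical increments,
   of column [i] below the current height and of column [i - 1] above it. *)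
Fixpoint flip_column i j a : nat * nat -> R :=
  if j is j'.+1 then corner_flip (i, 0)%N (0, j)%N (i, j) (flip_column i j' a)
  else a.

Fixpoint flip_columns i n a : nat * nat -> R :=
  if i is i'.+1 then flip_column i n (flip_columns i' n a) else a.

(** Subtracting the left or the lower neighbour from [lppSS] gives [w + (I - J)^+] or
    [w + (J - I)^+], the first two outputs of the corner flip. Each flip therefore carries the
    horizontal increment one level up and replaces one vertical increment of column [i] by that of
    column [i.+1]. *)
Lemma flip_columnP a b i n j : (j <= n)%N ->
  (forall l, (l < n)%N -> b (0, l.+1)%N = lpp a i l.+1 - lpp a i l) ->
  (forall k l, (i < k)%N -> b (k, l) = a (k, l)) ->
  let c := flip_column i.+1 j b in
  [/\ c (i.+1, 0)%N = lpp a i.+1 j - lpp a i j,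
      forall l, (l < j)%N -> c (0, l.+1)%N = lpp a i.+1 l.+1 - lpp a i.+1 l,
      forall l, (j <= l < n)%N -> c (0, l.+1)%N = lpp a i l.+1 - lpp a i l,
      forall l, (j < l)%N -> c (i.+1, l) = a (i.+1, l) &
      forall k l, (i.+1 < k)%N -> c (k, l) = a (k, l)].
Proof.
move=> + bv bk; elim: j => [|j IH] jn /=.
  split=> //; first by rewrite bk // lppS0 addrC addKr.
  - by move=> l _; apply: bk.
  - by move=> k l ik; apply: bk; apply: ltnW.
have [cI cL cU cw ck] := IH (ltnW jn).
set c := flip_column i.+1 j b in cI cL cU cw ck *.
have cJ : c (0, j.+1)%N = lpp a i j.+1 - lpp a i j by rewrite cU // leqnn.
have cW : c (i.+1, j.+1) = a (i.+1, j.+1) by rewrite cw.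
split.
- rewrite /corner_flip eqxx cI cJ cW lppSS.
  by case: leP => ?; case: leP => ?; lra.
- move=> l; rewrite ltnS leq_eqVlt => /orP[/eqP->|lj].
    rewrite /corner_flip !xpair_eqE /= eqxx cI cJ cW lppSS.
    by case: leP => ?; case: leP => ?; lra.
  by rewrite /corner_flip !xpair_eqE /= eqSS (ltn_eqF lj) cL.
- move=> l /andP[jl ln].
  by rewrite /corner_flip !xpair_eqE /= eqSS (gtn_eqF jl) cU // ln ltnW.
- move=> l jl; rewrite /corner_flip !xpair_eqE /= eqxx /=.
  by rewrite (gtn_eqF jl) (gtn_eqF (leq_ltn_trans _ jl)) // cw // ltnW.
- move=> k l ik; rewrite /corner_flip !xpair_eqE (gtn_eqF ik) /=.
  by rewrite (gtn_eqF (leq_ltn_trans (leq0n _) ik)) (ck k l ik).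
Qed.

Lemma flip_columnsP a n i :
  (forall l, (l < n)%N ->
    flip_columns i n a (0, l.+1)%N = lpp a i l.+1 - lpp a i l) /\
  (forall k l, (i < k)%N -> flip_columns i n a (k, l) = a (k, l)).
Proof.
elim: i => [|i [IHv IHk]].
  by split=> // l _; rewrite lpp0S addrC addKr.
have [_ cL _ _ ck] := flip_columnP (leqnn n) IHv IHk.
by split.
Qed.

(** The passage time telescopes along the bottom axis and then up column [m], whose vertical
    increments are what the sweep leaves on the vertical axis. *)
Lemma lpp_flip_columns a m n :
  lpp a m n = a (0, 0)%N + \sum_(l < m) a (l.+1, 0)%N +
    \sum_(l < n) flip_columns m n a (0, l.+1)%N.
Proof.
rewrite (eq_bigr (fun l : 'I_n => lpp a m l.+1 - lpp a m l)); last first.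
  by move=> l _; rewrite (flip_columnsP a n m).1.
rewrite -lppi0 -(big_mkord xpredT (fun l => lpp a m l.+1 - lpp a m l)).
by rewrite telescope_sumr // addrC subrK.
Qed.

End CornerFlips.

(** * Exponential laws *)

Section Density.
Local Open Scope ereal_scope.
Import HBNNSimple.

(** Linearity reduces simple functions to indicators, where the claim is the hypothesis on [m];
    monotone convergence extends it to [f]. *)
Lemma ge0_integral_density d (T : measurableType d) (R : realType)
    (mu m : {measure set T -> \bar R}) (g : T -> R) (f : T -> \bar R) :
  measurable_fun setT g -> (forall x, (0 <= g x)%R) ->
  (forall A, measurable A -> m A = \int[mu]_(x in A) (g x)%:E) ->
  measurable_fun setT f -> (forall x, 0 <= f x) ->
  \int[m]_x f x = \int[mu]_x (f x * (g x)%:E).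
Proof.
move=> mg g0 mE mf f0.
have mEg : measurable_fun setT (EFin \o g) by exact/measurable_EFinP.
have sfun (h : {nnsfun T >-> R}) :
    \int[m]_x (h x)%:E = \int[mu]_x ((h x)%:E * (g x)%:E).
  under [LHS]eq_integral do rewrite fimfunE -fsumEFin//.
  rewrite [LHS]ge0_integral_fsum//; last 2 first.
  - by move=> r; exact/measurable_EFinP/measurableT_comp.
  - by move=> n x _; rewrite EFinM nnfun_muleindic_ge0.
  under [RHS]eq_integral.
    move=> x xD; rewrite fimfunE -fsumEFin// muleC ge0_mule_fsumr; last first.
      by move=> r; rewrite EFinM nnfun_muleindic_ge0.
    over.
  rewrite [RHS]ge0_integral_fsum//; last 2 first.
  - move=> r; apply: emeasurable_funM => //.
    by apply/measurable_EFinP; do 2 apply/measurableT_comp => //.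
  - move=> n x _; rewrite mule_ge0 ?lee_fin //.
    by rewrite -lee_fin nnfun_muleindic_ge0.
  apply: eq_fsbigr => r _.
  rewrite integralZl_indic_nnsfun//= integral_indic// setIT mE //.
  have [->|r0] := eqVneq r 0%R.
    rewrite mul0e integral0_eq // => x _; by rewrite mul0r mule0.
  have [rneg|rpos] := ltP r 0%R.
    rewrite preimage_nnfun0 // integral_set0 mule0 integral0_eq // => x _.
    by rewrite indicE in_set0 mulr0 mule0.
  rewrite -ge0_integralZl //=.
  - rewrite integral_mkcond; apply: eq_integral => x _; rewrite patchE indicE.
    by case: ifPn => _; [rewrite mulr1 muleC|rewrite mulr0 mule0].
  - exact: measurable_funTS.
  - by move=> x _; rewrite lee_fin.
pose f_ := nnsfun_approx measurableT mf.
transitivity (lim (\int[m]_x (f_ n x)%:E @[n --> \oo])).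
  rewrite -monotone_convergence//=.
  - apply: eq_integral => ? /[!inE] xD; apply/esym/cvg_lim => //=.
    exact: cvg_nnsfun_approx.
  - by move=> n; exact/measurable_EFinP/measurable_funTS.
  - by move=> n ? _; rewrite lee_fin.
  - by move=> ? _ ? ? mn; rewrite lee_fin; exact/lefP/nd_nnsfun_approx.
transitivity (lim (\int[mu]_x ((f_ n x)%:E * (g x)%:E) @[n --> \oo])).
  by apply: congr_lim; apply/funext => n /=; exact: sfun.
rewrite -monotone_convergence//=.
- apply: eq_integral => x _; apply/cvg_lim => //=.
  by apply: cvgeZr => //; exact: cvg_nnsfun_approx.
- by move=> n; apply: emeasurable_funM => //; exact/measurable_EFinP.
- by move=> n x _; rewrite mule_ge0 // lee_fin.
- move=> x _ a b ab; rewrite lee_wpmul2r ?lee_fin //.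
  exact/lefP/nd_nnsfun_approx.
Qed.

End Density.

Section ExponentialLaw.
Variable R : realType.
Local Notation leb := (@lebesgue_measure R).
Local Open Scope ereal_scope.

(** The image of Lebesgue measure under the affine map, multiplied by [c], gives each half-open
    interval its length, so by uniqueness it is Lebesgue measure. *)
Lemma ge0_integral_affine (c d : R) (f : R -> \bar R) : (0 < c)%R ->
  measurable_fun setT f -> (forall x, 0 <= f x) ->
  \int[leb]_x f x = c%:E * \int[leb]_x f (c * x + d)%R.
Proof.
move=> c0 mf f0.
pose phi := (fun x => c * x + d : measurableTypeR R)%R.
have mphi : @measurable_fun _ _ (measurableTypeR R) (measurableTypeR R) setT phi.
  by apply: measurable_funD => //; apply: measurable_funM.
have [m mE <-] : exists2 m : {measure set (measurableTypeR R) -> \bar R},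
    forall A, m A = c%:E * leb (phi @^-1` A) &
    \int[m]_x f x = c%:E * \int[leb]_x f (phi x).
  unshelve eexists (mscale (NngNum (ltW c0)) (pushforward leb phi)) => //.
  rewrite ge0_integral_mscale //=; congr (_ * _).
  by rewrite ge0_integral_pushforward.
apply: eq_measure_integral => A mA _; apply: lebesgue_measure_unique => //.
move=> _ [[a b]] _ <-; rewrite mE.
have -> : phi @^-1` `]a, b] = `]((a - d) / c)%R, ((b - d) / c)%R]%classic.
  apply/seteqP; split => x /=; rewrite !in_itv /= /phi;
    by rewrite ltr_pdivrMr // ler_pdivlMr // ltrBlDr lerBrDr [(x * c)%R]mulrC.
rewrite !lebesgue_measure_itv /= !lte_fin ltr_pM2r ?invr_gt0 // ltrD2r.
case: ifPn => _; last by rewrite mule0.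
rewrite -!EFinB -EFinM; congr (_%:E).
by rewrite -mulrBl mulrCA divff ?gt_eqF // mulr1 opprB addrA subrK.
Qed.

Definition exponential_law (l : R) (m : set R -> \bar R) :=
  forall B, measurable B -> m B = exponential_prob l B.

Lemma exponential_pdf_if (l x : R) :
  exponential_pdf l x = if (0 <= x)%R then (l * expR (- l * x))%R else 0%R.
Proof.
by case: leP => [/exponential_pdfE|/lt0_exponential_pdf].
Qed.

Lemma ge0_integral_exponential_law (l : R) (m : {measure set R -> \bar R})
    (f : R -> \bar R) :
  (0 < l)%R -> exponential_law l m ->
  measurable_fun setT f -> (forall x, 0 <= f x) ->
  \int[m]_x f x = \int[leb]_x (f x * (exponential_pdf l x)%:E).
Proof.
(* The identity transports the law to [measurableTypeR R], the copy of the reals that carries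
   Lebesgue measure. *)
move=> l0 ml mf f0; pose idR : R -> measurableTypeR R := idfun.
have midR : measurable_fun setT idR by move=> _ B mB; rewrite setTI.
have [m' m'E ->] : exists2 m' : {measure set (measurableTypeR R) -> \bar R},
    forall A, m' A = m A & \int[m]_x f x = \int[m']_x f x.
  unshelve eexists (pushforward m idR) => //.
  by rewrite [RHS]ge0_integral_pushforward.
apply: ge0_integral_density => //; last by move=> A mA; rewrite m'E ml.
- exact: measurable_exponential_pdf.
- by move=> x; rewrite exponential_pdf_ge0 // ltW.
Qed.

Lemma eq_integral_exponential_law (l : R) (m : {measure set R -> \bar R})
    (f g : R -> \bar R) :
  (0 < l)%R -> exponential_law l m ->
  measurable_fun setT f -> (forall x, 0 <= f x) ->
  measurable_fun setT g -> (forall x, 0 <= g x) ->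
  (forall x, (0 <= x)%R -> f x = g x) ->
  \int[m]_x f x = \int[m]_x g x.
Proof.
move=> l0 ml mf f0 mg g0 fg; rewrite !(ge0_integral_exponential_law l0 ml) //.
apply: eq_integral => x _; have [/fg -> //|x0] := leP 0%R x.
by rewrite lt0_exponential_pdf // !mule0.
Qed.

(** Exponential tilting: multiplying the density of rate [l] by [expR (c * x)] gives [l / (l - c)]
    times the density of rate [l - c]. *)
Lemma ge0_integral_exponential_law_tilt (l c : R)
    (m : {measure set R -> \bar R})
    (f : R -> \bar R) :
  (0 < l)%R -> (c < l)%R -> exponential_law l m ->
  measurable_fun setT f -> (forall x, 0 <= f x) ->
  \int[m]_x ((expR (c * x))%:E * f x) =
  (l / (l - c))%:E * \int[leb]_x (f x * (exponential_pdf (l - c) x)%:E).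
Proof.
move=> l0 cl ml mf f0; have lc : (0 < l - c)%R by rewrite subr_gt0.
have mpdf k : measurable_fun setT (fun x : R => (exponential_pdf k x)%:E).
  by apply/measurable_EFinP; exact: measurable_exponential_pdf.
have mexp : measurable_fun setT (fun x : R => (expR (c * x))%:E).
  by apply/measurable_EFinP; apply: measurableT_comp => //; exact: measurable_funM.
rewrite (ge0_integral_exponential_law l0 ml); last 2 first.
- exact: emeasurable_funM.
- by move=> x; rewrite mule_ge0 // lee_fin expR_ge0.
rewrite -ge0_integralZl //.
- apply: eq_integral => x _; rewrite !exponential_pdf_if.
  case: ifPn => _; last by rewrite !mule0.
  rewrite [LHS]muleAC [RHS]muleCA -!EFinM [RHS]muleC; congr (_%:E * _).
  rewrite [in RHS]mulrA divfK ?gt_eqF // mulrCA -expRD; congr (_ * expR _)%R.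
  ring.
- apply: emeasurable_funM; [exact: mf|exact: mpdf].
- by move=> x _; rewrite mule_ge0 // lee_fin exponential_pdf_ge0 // ltW.
- by rewrite lee_fin divr_ge0 // ltW.
Qed.

Lemma exponential_law_mmt_gen (l c : R) (m : {measure set R -> \bar R}) :
  (0 < l)%R -> (c < l)%R -> exponential_law l m ->
  \int[m]_x (expR (c * x))%:E = (l / (l - c))%:E.
Proof.
move=> l0 cl ml.
under eq_integral do rewrite -[_%:E]mule1.
rewrite (@ge0_integral_exponential_law_tilt l) //.
under eq_integral do rewrite mul1e.
by rewrite integral_exponential_pdf ?mule1 // subr_gt0.
Qed.

(** Memorylessness: substitute [x + (y - w)] for [x]. The support condition on [C] keeps both the
    old and the new argument of the density nonnegative, so the densities differ by a constant
    factor. *)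
Lemma exponential_law_shift (l y w : R) (m : {measure set R -> \bar R})
    (C : set R) (f : R -> \bar R) :
  (0 < l)%R -> exponential_law l m -> measurable C ->
  C `<=` `[0%R, +oo[%classic -> measurable_fun setT f -> (forall x, 0 <= f x) ->
  (0 <= y)%R -> (0 <= w)%R ->
  \int[m]_x ((\1_C (x - y)%R)%:E * f (w + (x - y))%R) =
  (expR (l * (w - y)))%:E * \int[m]_x ((\1_C (x - w)%R)%:E * f x).
Proof.
move=> l0 ml mC C0 mf f0 y0 w0.
have m1 (z : R) : measurable_fun setT (fun x : R => (\1_C (x - z)%R)%:E : \bar R).
  apply/measurable_EFinP; apply: measurableT_comp; first exact: measurable_indic.
  exact: measurable_funB.
have mpdf k : measurable_fun setT (fun x : R => (exponential_pdf k x)%:E).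
  by apply/measurable_EFinP; exact: measurable_exponential_pdf.
have mfs : measurable_fun setT (fun x : R => f (w + (x - y))%R).
  by apply: measurableT_comp => //; apply: measurable_funD => //;
     exact: measurable_funB.
have ind0 z : 0 <= (\1_C z)%:E :> \bar R by rewrite lee_fin.
have pdf0 z : 0 <= (exponential_pdf l z)%:E.
  by rewrite lee_fin exponential_pdf_ge0 // ltW.
rewrite !(ge0_integral_exponential_law l0 ml); last 4 first.
- exact: emeasurable_funM.
- by move=> x; exact: mule_ge0.
- exact: emeasurable_funM.
- by move=> x; exact: mule_ge0.
pose F (x : R) : \bar R := (\1_C (x - y)%R)%:E * f (w + (x - y))%R *
  (exponential_pdf l x)%:E.
have mF : measurable_fun setT F.
  by apply: emeasurable_funM => //; exact: emeasurable_funM.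
have F0 x : 0 <= F x by apply: mule_ge0 => //; exact: mule_ge0.
transitivity (\int[leb]_x F x) => //.
rewrite (ge0_integral_affine (y - w)%R ltr01 mF F0) /F.
rewrite mul1e -ge0_integralZl //; last 2 first.
- apply: emeasurable_funM; last exact: mpdf.
  by apply: emeasurable_funM; [exact: m1|exact: mf].
- by move=> x _; apply: mule_ge0 => //; exact: mule_ge0.
apply: eq_integral => x _; rewrite mul1r.
have -> : (x + (y - w) - y = x - w)%R by ring.
have -> : (w + (x - w) = x)%R by ring.
rewrite [RHS]muleC -[RHS]muleA -!muleA indicE.
have [xC|] := boolP (x - w \in C)%R; last by rewrite !mul0e.
have xw : (0 <= x - w)%R by move: xC => /set_mem/C0; rewrite /= in_itv /= andbT.
congr (_ * (_ * _)); rewrite -EFinM !exponential_pdf_if.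
have -> : (0 <= x)%R by rewrite (le_trans w0) // -subr_ge0.
have -> : (0 <= x + (y - w))%R by rewrite addrCA addr_ge0.
congr (_%:E); rewrite -mulrA -expRD; congr (_ * expR _)%R; ring.
Qed.

End ExponentialLaw.

(** * Burke's property *)

Section Burke.
Variable R : realType.
Local Open Scope ereal_scope.

Lemma integral_indicE (m : probability R R) (B : set R) : measurable B ->
  \int[m]_x (\1_B x)%:E = m B.
Proof. by move=> mB; rewrite integral_indic // setIT. Qed.

Lemma measurable_indic_comp d (T : measurableType d) (B : set R) (f : T -> R) :
  measurable B -> measurable_fun setT f ->
  measurable_fun setT (fun x => (\1_B (f x))%:E : \bar R).
Proof.
by move=> mB mf; apply/measurable_EFinP; exact: measurableT_comp.
Qed.

Let gap (m : probability R R) (C B : set R) (w : R) : \bar R :=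
  \int[m]_p ((\1_C (p - w)%R)%:E * (\1_B p)%:E).

Let ind0 (B : set R) (z : R) : 0 <= (\1_B z)%:E :> \bar R.
Proof. by rewrite lee_fin. Qed.

Let gap_ge0 m C B w : 0 <= gap m C B w.
Proof. by apply: integral_ge0 => p _; apply: mule_ge0. Qed.

Let measurable_gap m C B : measurable C -> measurable B ->
  measurable_fun setT (gap m C B).
Proof.
move=> mC mB.
pose f (z : R * R) : \bar R := (\1_C (z.2 - z.1)%R)%:E * (\1_B z.2)%:E.
apply: (@measurable_fun_fubini_tonelli_F _ _ _ _ _ m f); last first.
  by move=> z; apply: mule_ge0.
apply: emeasurable_funM; apply: measurable_indic_comp => //.
by apply: measurable_funB; [exact: measurable_snd|exact: measurable_fst].
Qed.

Let F (C B1 B2 B3 : set R) (x y w : R) : \bar R :=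
  (\1_C (x - y)%R)%:E * (\1_B1 (w + (x - y))%R)%:E *
  ((\1_B2 w)%:E * (\1_B3 y)%:E).

Let F_ge0 C B1 B2 B3 x y w : 0 <= F C B1 B2 B3 x y w.
Proof. by rewrite /F !mule_ge0. Qed.

Let measurable_F C B1 B2 B3 : measurable C -> measurable B1 ->
  measurable B2 -> measurable B3 ->
  measurable_fun setT (fun z : (R * R) * R => F C B1 B2 B3 z.1.1 z.1.2 z.2).
Proof.
move=> mC mB1 mB2 mB3.
have m11 : measurable_fun setT (fun z : (R * R) * R => z.1.1).
  exact: measurableT_comp.
have m12 : measurable_fun setT (fun z : (R * R) * R => z.1.2).
  exact: measurableT_comp.
have m1B : measurable_fun setT (fun z : (R * R) * R => z.1.1 - z.1.2)%R.
  exact: measurable_funB.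
apply: emeasurable_funM; apply: emeasurable_funM;
  apply: measurable_indic_comp => //.
exact: measurable_funD.
Qed.

(* The contribution of [{x - y \in C}], where [C] is a half-line of
   nonnegative reals: there the output of the corner flip is
   [(w + (x - y), w, y)]. *)
Lemma burke_half (al be : R) (m1 m2 m3 : probability R R) (C B1 B2 B3 : set R) :
  (0 < al)%R -> (0 < be)%R -> (al + be = 1)%R ->
  exponential_law al m1 -> exponential_law be m2 -> exponential_law 1 m3 ->
  measurable C -> measurable B1 -> measurable B2 -> measurable B3 ->
  C `<=` `[0%R, +oo[%classic ->
  \int[m1]_x \int[m2]_y \int[m3]_w F C B1 B2 B3 x y w =
  m3 B3 * \int[m2]_y ((\1_B2 y)%:E * gap m1 C B1 y).
Proof.
move=> al0 be0 ab e1 e2 e3 mC mB1 mB2 mB3 C0.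
have F0 x y w := F_ge0 C B1 B2 B3 x y w.
have mF := measurable_F mC mB1 mB2 mB3.
(* The integral over [x] is brought innermost, so that [exponential_law_shift] can be used at fixed
   [y] and [w]. *)
rewrite (@fubini_tonelli _ _ _ _ _ m1 m2
  (fun z => \int[m3]_w F C B1 B2 B3 z.1 z.2 w)) /=; last 2 first.
- apply: (@measurable_fun_fubini_tonelli_F _ _ _ _ _ m3
    (fun z : (R * R) * R => F C B1 B2 B3 z.1.1 z.1.2 z.2)) => //.
- by move=> z; apply: integral_ge0.
under eq_integral => y _.
  rewrite (@fubini_tonelli _ _ _ _ _ m1 m3 (fun z => F C B1 B2 B3 z.1 y z.2)) //=; last first.
    have mp : measurable_fun setT (fun z : R * R => ((z.1, y), z.2)).
      by apply: measurable_fun_pair => //; apply: measurable_fun_pair.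
    exact: (measurableT_comp mF mp).
  over.
have mFx : measurable_fun setT (fun z : R * R => \int[m1]_x F C B1 B2 B3 x z.1 z.2).
  apply: (@measurable_fun_fubini_tonelli_F _ _ _ _ _ m1
    (fun z : (R * R) * R => F C B1 B2 B3 z.2 z.1.1 z.1.2)) => //.
  have mp : measurable_fun setT
      (fun z : (R * R) * R => ((z.2, z.1.1), z.1.2)).
    apply: measurable_fun_pair; last exact: measurableT_comp.
    by apply: measurable_fun_pair => //; exact: measurableT_comp.
  exact: (measurableT_comp mF mp).
(* After the shift in [x] the integrand separates into [c y] and [expR (al * w) * g w]. *)
pose c (y : R) : \bar R := (expR (- al * y))%:E * (\1_B3 y)%:E.
pose g (w : R) : \bar R := (\1_B2 w)%:E * gap m1 C B1 w.
have mexp (k : R) : measurable_fun setT (fun x : R => (expR (k * x))%:E : \bar R).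
  apply/measurable_EFinP; apply: measurableT_comp => //; exact: measurable_funM.
have mc : measurable_fun setT c.
  by apply: emeasurable_funM => //; apply: measurable_indic_comp.
have mg : measurable_fun setT g.
  by apply: emeasurable_funM => //; [apply: measurable_indic_comp|
    apply: measurable_gap].
have c0 y : 0 <= c y by apply: mule_ge0 => //; rewrite lee_fin expR_ge0.
have g0 w : 0 <= g w by apply: mule_ge0 => //; apply: gap_ge0.
have eg0 w : 0 <= (expR (al * w))%:E * g w.
  by apply: mule_ge0 => //; rewrite lee_fin expR_ge0.
have al1 : (al < 1)%R by rewrite -ab ltrDl.
(* Tilting rate 1 by [al] leaves rate [1 - al = be]: the variable [w] acquires the law of [y]. *)
have K : \int[m3]_w ((expR (al * w))%:E * g w) = be^-1%:E * \int[m2]_w g w.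
  rewrite (@ge0_integral_exponential_law_tilt _ 1) //.
  have -> : (1 - al = be)%R by rewrite -ab addrC addKr.
  by rewrite div1r -(ge0_integral_exponential_law be0 e2).
have meg : measurable_fun setT (fun w : R => (expR (al * w))%:E * g w).
  exact: emeasurable_funM.
transitivity (\int[m2]_y (c y * \int[m3]_w ((expR (al * w))%:E * g w))).
  (* The shift is valid only for nonnegative [y] and [w], which is enough under exponential laws. *)
  apply: (eq_integral_exponential_law be0 e2).
  - apply: (@measurable_fun_fubini_tonelli_F _ _ _ _ _ m3
      (fun z : R * R => \int[m1]_x F C B1 B2 B3 x z.1 z.2)) => //.
    by move=> z; apply: integral_ge0.
  - by move=> y; apply: integral_ge0 => w _; apply: integral_ge0.
  - apply: emeasurable_funM => //; exact: measurable_cst.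
  - by move=> y; apply: mule_ge0 => //; apply: integral_ge0.
  move=> y y0; rewrite -ge0_integralZl //.
  apply: (eq_integral_exponential_law ltr01 e3).
  - have mp : measurable_fun setT (fun w : R => (y, w)).
      exact: measurable_fun_pair.
    exact: (measurableT_comp mFx mp).
  - by move=> w; apply: integral_ge0.
  - by apply: emeasurable_funM.
  - by move=> w; apply: mule_ge0.
  move=> w w0; rewrite /F.
  have mshift : measurable_fun setT (fun x : R =>
      (\1_C (x - y)%R)%:E * (\1_B1 (w + (x - y))%R)%:E : \bar R).
    apply: emeasurable_funM; apply: measurable_indic_comp => //.
      exact: measurable_funB.
    by apply: measurable_funD => //; exact: measurable_funB.
  rewrite ge0_integralZr // ?mule_ge0 //.
  rewrite (exponential_law_shift al0 e1 mC C0
    (f := fun x : R => (\1_B1 x)%:E)) //; last exact: measurable_indic_comp.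
  rewrite -/(gap m1 C B1 w) /c /g mulrBr expRD EFinM.
  have -> : (- (al * y) = - al * y)%R by rewrite mulNr.
  rewrite -!muleA; rewrite [LHS]muleC -!muleA.
  congr (_ * _); rewrite [LHS]muleC -!muleA [LHS]muleCA; congr (_ * _).
  by rewrite muleCA.
rewrite K ge0_integralZr //; last first.
  by apply: mule_ge0; [rewrite lee_fin invr_ge0 ltW|exact: integral_ge0].
(* Conversely, tilting rate [be] by [- al] gives rate 1, so [y] acquires the law of [w]; the
   constant [be] cancels the [be^-1] of [K]. *)
rewrite /c (@ge0_integral_exponential_law_tilt _ be) //; last 2 first.
- by rewrite (lt_trans _ be0) // oppr_lt0.
- exact: measurable_indic_comp.
rewrite opprK [(be + al)%R]addrC ab divr1.
rewrite -(ge0_integral_exponential_law ltr01 e3) //; last exact: measurable_indic_comp.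
rewrite integral_indicE // [X in X * _]muleC -muleA; congr (_ * _).
by rewrite muleA -EFinM divff ?gt_eqF // mul1e.
Qed.

(** Burke's property. The cases [y <= x] and [x < y] are two instances of [burke_half] with the
    roles of the axes exchanged; ties go to the first. *)
Lemma corner_flip_law (al be : R) (ma mb mc : probability R R)
    (B1 B2 B3 : set R) :
  (0 < al)%R -> (0 < be)%R -> (al + be = 1)%R ->
  exponential_law al ma -> exponential_law be mb -> exponential_law 1 mc ->
  measurable B1 -> measurable B2 -> measurable B3 ->
  \int[ma]_x \int[mb]_y \int[mc]_w
    ((\1_B1 (w + Num.max (x - y) 0)%R)%:E *
     (\1_B2 (w + Num.max (y - x) 0)%R)%:E * (\1_B3 (Num.min x y))%:E) =
  ma B1 * mb B2 * mc B3.
Proof.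
move=> al0 be0 ab ea eb ec mB1 mB2 mB3.
pose C1 : set R := `[0%R, +oo[%classic; pose C2 : set R := `]0%R, +oo[%classic.
have mC1 : measurable C1 by exact: measurable_itv.
have mC2 : measurable C2 by exact: measurable_itv.
have C1E (z : R) : z \in C1 = (0 <= z)%R.
  by rewrite mem_setE in_itv /= andbT.
have C2E (z : R) : z \in C2 = (0 < z)%R.
  by rewrite mem_setE in_itv /= andbT.
have C20 : C2 `<=` `[0%R, +oo[%classic.
  by move=> x; rewrite /C2 /= !in_itv /= !andbT => /ltW.
pose F1 := F C1 B1 B2 B3; pose F2 := F C2 B2 B1 B3.
have mF1 : measurable_fun setT (fun z : (R * R) * R => F1 z.1.1 z.1.2 z.2).
  exact: measurable_F.
have mF2 : measurable_fun setT (fun z : (R * R) * R => F2 z.1.2 z.1.1 z.2).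
  have mp : measurable_fun setT (fun z : (R * R) * R => ((z.1.2, z.1.1), z.2)).
    apply: measurable_fun_pair => //.
    by apply: measurable_fun_pair; exact: measurableT_comp.
  exact: (measurableT_comp (measurable_F mC2 mB2 mB1 mB3) mp).
have F10 x y w : 0 <= F1 x y w by exact: F_ge0.
have F20 x y w : 0 <= F2 x y w by exact: F_ge0.
have mF1w : measurable_fun setT (fun z : R * R => \int[mc]_w F1 z.1 z.2 w).
  exact: (@measurable_fun_fubini_tonelli_F _ _ _ _ _ mc
    (fun z : (R * R) * R => F1 z.1.1 z.1.2 z.2)).
have mF2w : measurable_fun setT (fun z : R * R => \int[mc]_w F2 z.2 z.1 w).
  exact: (@measurable_fun_fubini_tonelli_F _ _ _ _ _ mc
    (fun z : (R * R) * R => F2 z.1.2 z.1.1 z.2)).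
transitivity (\int[ma]_x (\int[mb]_y \int[mc]_w F1 x y w +
    \int[mb]_y \int[mc]_w F2 y x w)).
  apply: eq_integral => x _.
  have mx : measurable_fun setT (fun y : R => (x, y)).
    exact: measurable_fun_pair.
  rewrite -ge0_integralD //; last 4 first.
  - by move=> y _; apply: integral_ge0.
  - exact: (measurableT_comp mF1w mx).
  - by move=> y _; apply: integral_ge0.
  - exact: (measurableT_comp mF2w mx).
  apply: eq_integral => y _.
  have mxy : measurable_fun setT (fun w : R => ((x, y), w)).
    exact: measurable_fun_pair.
  rewrite -ge0_integralD //; last 2 first.
  - exact: (measurableT_comp mF1 mxy).
  - exact: (measurableT_comp mF2 mxy).
  apply: eq_integral => w _; rewrite /F1 /F2 /F ![\1_C1 _]indicE C1E.
  rewrite ![\1_C2 _]indicE C2E subr_ge0 subr_gt0.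
  have [yx|xy] := leP y x.
    rewrite mul1e !mul0e adde0 (max_l _) ?subr_ge0 // (max_r _) ?subr_le0 //.
    by rewrite addr0 ?min_r // muleA.
  rewrite !mul0e mul1e add0e (max_r _) ?subr_le0 ?ltW //.
  rewrite (max_l _) ?subr_ge0 ?ltW // addr0.
  by rewrite -!muleA muleCA.
rewrite ge0_integralD //; last 4 first.
- by move=> x _; do 2 (apply: integral_ge0 => ? _).
- exact: (@measurable_fun_fubini_tonelli_F _ _ _ _ _ mb
    (fun z : R * R => \int[mc]_w F1 z.1 z.2 w) mF1w
    (fun z => integral_ge0 _ (fun w _ => F10 _ _ _))).
- by move=> x _; do 2 (apply: integral_ge0 => ? _).
- exact: (@measurable_fun_fubini_tonelli_F _ _ _ _ _ mb
    (fun z : R * R => \int[mc]_w F2 z.2 z.1 w) mF2w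
    (fun z => integral_ge0 _ (fun w _ => F20 _ _ _))).
have eF2 : \int[ma]_x \int[mb]_y \int[mc]_w F2 y x w =
    \int[mb]_y \int[ma]_x \int[mc]_w F2 y x w.
  apply: (@fubini_tonelli _ _ _ _ _ ma mb
    (fun z : R * R => \int[mc]_w F2 z.2 z.1 w) mF2w).
  by move=> z; apply: integral_ge0.
have ba : (be + al = 1)%R by rewrite addrC.
transitivity (mc B3 * (\int[mb]_y ((\1_B2 y)%:E * gap ma C1 B1 y)) +
    mc B3 * (\int[ma]_y ((\1_B1 y)%:E * gap mb C2 B2 y))).
  apply: f_equal2.
    exact: (burke_half al0 be0 ab ea eb ec mC1 mB1 mB2 mB3 (fun x => id)).
  apply: (etrans eF2).
  exact: (burke_half be0 al0 ba eb ea ec mC2 mB2 mB1 mB3 C20).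
rewrite -ge0_muleDr; last 2 first.
- by apply: integral_ge0 => y _; apply: mule_ge0 => //; exact: gap_ge0.
- by apply: integral_ge0 => y _; apply: mule_ge0 => //; exact: gap_ge0.
rewrite [LHS]muleC; congr (_ * _).
pose G1 (z : R * R) : \bar R :=
  (\1_C1 (z.1 - z.2)%R)%:E * ((\1_B1 z.1)%:E * (\1_B2 z.2)%:E).
pose G2 (z : R * R) : \bar R :=
  (\1_C2 (z.2 - z.1)%R)%:E * ((\1_B1 z.1)%:E * (\1_B2 z.2)%:E).
have G10 z : 0 <= G1 z by rewrite /G1 !mule_ge0.
have G20 z : 0 <= G2 z by rewrite /G2 !mule_ge0.
have mB12 : measurable_fun setT
    (fun z : R * R => (\1_B1 z.1)%:E * (\1_B2 z.2)%:E : \bar R).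
  by apply: emeasurable_funM; apply: measurable_indic_comp.
have mG1 : measurable_fun setT G1.
  apply: emeasurable_funM => //; apply: measurable_indic_comp => //.
  exact: measurable_funB.
have mG2 : measurable_fun setT G2.
  apply: emeasurable_funM => //; apply: measurable_indic_comp => //.
  exact: measurable_funB.
have mind (C B : set R) (c : R) : measurable C -> measurable B ->
    measurable_fun setT (fun p : R => (\1_C (p - c)%R)%:E * (\1_B p)%:E : \bar R).
  move=> mC mB; apply: emeasurable_funM; apply: measurable_indic_comp => //.
  exact: measurable_funB.
(* [G1] and [G2] restrict the product integrand to [q <= p] and to [p < q], so together they
   recombine into the unrestricted one. *)
transitivity (\int[ma]_p \int[mb]_q G1 (p, q) + \int[ma]_p \int[mb]_q G2 (p, q)).
  rewrite fubini_tonelli //; congr (_ + _).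
    apply: eq_integral => q _; rewrite -ge0_integralZl //; last exact: mind.
    by apply: eq_integral => p _; rewrite /G1 /= muleC -muleA.
  apply: eq_integral => q _; rewrite -ge0_integralZl //; last exact: mind.
  by apply: eq_integral => p _; rewrite /G2 /= muleCA.
have mG1p := @measurable_fun_fubini_tonelli_F _ _ _ _ _ mb _ mG1 G10.
have mG2p := @measurable_fun_fubini_tonelli_F _ _ _ _ _ mb _ mG2 G20.
rewrite -ge0_integralD //; last 2 first.
- by move=> p _; apply: integral_ge0.
- by move=> p _; apply: integral_ge0.
transitivity (\int[ma]_p ((\1_B1 p)%:E * mb B2)).
  apply: eq_integral => p _.
  have mp : measurable_fun setT (fun q : R => (p, q)).
    exact: measurable_fun_pair.
  rewrite -ge0_integralD //; last 2 first.
  - exact: (measurableT_comp mG1 mp).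
  - exact: (measurableT_comp mG2 mp).
  rewrite -integral_indicE // -ge0_integralZl //; last exact: measurable_indic_comp.
  apply: eq_integral => q _; rewrite /G1 /G2 /= ![\1_C1 _]indicE C1E.
  rewrite ![\1_C2 _]indicE C2E subr_ge0 subr_gt0.
  by case: leP => _; rewrite mul1e mul0e ?adde0 ?add0e.
rewrite ge0_integralZr ?integral_indicE //; exact: measurable_indic_comp.
Qed.
End Burke.

(** * Independence *)

Lemma measure_unique_rectangles (d1 d2 : measure_display) (R : realType)
    (T1 : measurableType d1) (T2 : measurableType d2)
    (m1 m2 : {measure set (T1 * T2) -> \bar R}) :
  (m1 setT < +oo)%E ->
  (forall A B, measurable A -> measurable B -> m1 (A `*` B) = m2 (A `*` B)) ->
  forall E, measurable E -> m1 E = m2 E.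
Proof.
move=> m1oo m12 E mE.
pose C : set (set (T1 * T2)) :=
  [set A `*` B | A in measurable & B in measurable].
apply: (measure_unique C (fun=> setT)) => //.
- exact: measurable_prod_measurableType.
- move=> _ _ [A1 mA1 [A2 mA2 <-]] [B1 mB1 [B2 mB2 <-]]; rewrite -setXI.
  by exists (A1 `&` B1); [exact: measurableI|]; exists (A2 `&` B2);
    [exact: measurableI|].
- by move=> _; exists setT => //; exists setT => //; rewrite setXTT.
- by rewrite bigcup_const //; exists 0%N.
- by move=> _ [A mA [B mB <-]]; exact: m12.
Qed.

Section Independence.
Context (R : realType) (d : measure_display) (Omega : measurableType d).
Variable P : probability Omega R.

Definition rv (d' : measure_display) (T : measurableType d') (f : Omega -> T)
    (mf : measurable_fun setT f) : {RV P >-> T} :=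
  HB.pack f (isMeasurableFun.Build _ _ _ _ f mf).

Section Families.
Variables (I : choiceType) (X : I -> {RV P >-> R}).
Implicit Types (s t : seq I) (B : I -> set R).

Definition cylinder s B : set Omega :=
  [set w | forall i, i \in s -> X i w \in B i].

Lemma measurable_rv_preimage d' (T : measurableType d') (V : {RV P >-> T}) A :
  measurable A -> measurable (V @^-1` A).
Proof. by move=> mA; rewrite -[_ @^-1` _]setTI; exact: measurable_funP. Qed.

Lemma cylinder_nil B : cylinder [::] B = setT.
Proof. by apply/seteqP; split. Qed.

Lemma cylinder_cons i s B :
  cylinder (i :: s) B = X i @^-1` B i `&` cylinder s B.
Proof.
apply/seteqP; split => w /=.
  move=> wB; split; first by apply: set_mem; apply: wB; rewrite mem_head.
  by move=> j js; apply: wB; rewrite inE js orbT.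
move=> [wi wB] j; rewrite inE => /orP[/eqP->|/wB //]; exact: mem_set.
Qed.

Lemma measurable_cylinder s B : (forall i, measurable (B i)) ->
  measurable (cylinder s B).
Proof.
move=> mB; elim: s => [|i s IH]; first by rewrite cylinder_nil.
by rewrite cylinder_cons; apply: measurableI => //; exact: measurable_rv_preimage.
Qed.

(** [t] stands for the coordinates that [V] may depend on. This form lets functions of several
    coordinates be built one coordinate at a time while staying independent of the others. *)
Definition independent_off t d' (T : measurableType d') (V : {RV P >-> T}) :=
  forall s B A, uniq s -> (forall i, i \in s -> i \notin t) ->
    (forall i, measurable (B i)) -> measurable A ->
    P (cylinder s B `&` V @^-1` A) = (P (cylinder s B) * P (V @^-1` A))%E.

Hypothesis Xindep : mutually_independent X.

Lemma probability_cylinder s B : uniq s -> (forall i, measurable (B i)) ->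
  P (cylinder s B) = (\prod_(i <- s) P (X i @^-1` B i))%E.
Proof. by move=> us mB; apply: Xindep. Qed.

Lemma independent_off1 i : independent_off [:: i] (X i).
Proof.
move=> s B A us si mB mA.
pose B' j := if j == i then A else B j.
have B'i : B' i = A by rewrite /B' eqxx.
have is' : i \notin s by apply/negP => /si; rewrite inE eqxx.
have sB' : cylinder s B' = cylinder s B.
  apply/seteqP; split => w wB j js; move: (wB j js); rewrite /B';
    by have := si j js; rewrite inE => /negbTE ->.
rewrite setIC -sB'.
have -> : X i @^-1` A `&` cylinder s B' = cylinder (i :: s) B'.
  by rewrite cylinder_cons B'i.
have mB' j : measurable (B' j) by rewrite /B'; case: ifP.
rewrite !probability_cylinder //=; last by rewrite is'.
by rewrite big_cons muleC B'i.
Qed.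

Lemma independent_off_cst t (c : R) : independent_off t (rv (measurable_cst c)).
Proof.
move=> s B A _ _ mB mA; rewrite /rv /=.
have [cA|cA] := pselect (A c).
  have -> : (cst c : Omega -> R) @^-1` A = setT by apply/seteqP; split.
  by rewrite setIT probability_setT mule1.
have -> : (cst c : Omega -> R) @^-1` A = set0 by apply/seteqP; split.
by rewrite setI0 measure0 mule0.
Qed.

Lemma independent_off_comp t d1 d2 (T1 : measurableType d1)
    (T2 : measurableType d2) (V : {RV P >-> T1}) (f : T1 -> T2)
    (mf : measurable_fun setT f) (W : {RV P >-> T2}) :
  independent_off t V -> (forall w, W w = f (V w)) -> independent_off t W.
Proof.
move=> iV WE s B A us st mB mA.
have -> : W @^-1` A = V @^-1` (f @^-1` A).
  by apply/seteqP; split => w /=; rewrite WE.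
by apply: iV => //; rewrite -[_ @^-1` _]setTI; exact: mf.
Qed.

Section Pair.
Variables (t : seq I) (d' : measure_display) (T : measurableType d').
Variables (V : {RV P >-> T}) (i : I).
Hypotheses (iV : independent_off t V) (it : i \notin t).

Definition rv_pair : {RV P >-> (T * R)%type} :=
  rv (measurable_fun_pair (measurable_funPT V) (measurable_funPT (X i))).

Let pair_rect s B A A' : uniq s -> (forall j, j \in s -> j \notin i :: t) ->
    (forall j, measurable (B j)) -> measurable A -> measurable A' ->
  P (cylinder s B `&` rv_pair @^-1` (A `*` A')) =
    (P (cylinder s B) * (P (V @^-1` A) * P (X i @^-1` A')))%E.
Proof.
move=> us st mB mA mA'.
pose B' j := if j == i then A' else B j.
have B'i : B' i = A' by rewrite /B' eqxx.
have mB' j : measurable (B' j) by rewrite /B'; case: ifP.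
have is' : i \notin s by apply/negP => /st; rewrite mem_head.
have sB' : cylinder s B' = cylinder s B.
  apply/seteqP; split => w wB j js; move: (wB j js); rewrite /B';
    by have := st j js; rewrite inE negb_or => /andP[/negbTE ->].
have cE : X i @^-1` A' `&` cylinder s B = cylinder (i :: s) B'.
  by rewrite cylinder_cons B'i sB'.
have -> : cylinder s B `&` rv_pair @^-1` (A `*` A') =
    cylinder (i :: s) B' `&` V @^-1` A.
  rewrite -cE; apply/seteqP; split => w /= => [[c [a a']]|[[a' c] a]];
    by split.
rewrite iV //=; first last.
- move=> j; rewrite inE => /orP[/eqP -> //|/st].
  by rewrite inE negb_or => /andP[].
- by rewrite is'.
rewrite -cE setIC independent_off1 //; last first.
  by move=> j /st; rewrite !inE negb_or => /andP[].
by rewrite -!muleA; congr (_ * _)%E; rewrite muleC.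
Qed.

Lemma rv_pair_law E : measurable E ->
  P (rv_pair @^-1` E) = (distribution P V \x distribution P (X i))%E E.
Proof.
move=> mE; apply/esym.
apply: (@product_measure_unique _ _ _ _ _ _ _ (distribution P rv_pair)) => //.
move=> A A' mA mA'; have := @pair_rect [::] (fun=> setT) A A' isT.
rewrite cylinder_nil setTI probability_setT mul1e; exact.
Qed.

(** Both sides are finite measures in [E]. They agree on rectangles, where the condition on [X i]
    can be moved into the cylinder, and hence everywhere. *)
Lemma independent_off_pair : independent_off (i :: t) rv_pair.
Proof.
move=> s B E us st mB mE.
have mC := measurable_cylinder s mB.
have PC : P (cylinder s B) = (fine (P (cylinder s B)))%:E.
  by rewrite fineK // fin_num_measure.
have PC0 : 0 <= fine (P (cylinder s B)) by rewrite fine_ge0.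
have mp := measurable_funPT rv_pair.
have [m1 m1E] : exists m1 : {measure set (T * R) -> \bar R},
    forall F, m1 F = P (cylinder s B `&` rv_pair @^-1` F).
  unshelve eexists (pushforward (mrestr P mC) rv_pair) => // F.
  by rewrite /pushforward /mrestr setIC.
rewrite -m1E PC.
change (m1 E = mscale (NngNum PC0) (distribution P rv_pair) E).
apply: measure_unique_rectangles => //.
- rewrite m1E (le_lt_trans (probability_le1 _ _)) ?ltry //.
  by apply: measurableI => //; exact: measurable_rv_preimage.
- move=> A A' mA mA'; rewrite m1E pair_rect // /mscale /= [in LHS]PC; congr (_ * _)%E.
  have := @pair_rect [::] (fun=> setT) A A' isT.
  by rewrite cylinder_nil setTI probability_setT mul1e => <-.
Qed.

End Pair.
End Families.
End Independence.

(** * Corner flips of independent families *)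

Section FlipFamily.
Context (R : realType) (d : measure_display) (Omega : measurableType d).
Variables (P : probability Omega R) (I : choiceType).
Implicit Types X Y : I -> {RV P >-> R}.

(** An index list can be enlarged to contain [t] by imposing [setT] at the added indices: the event
    is unchanged and the new factors are 1. *)
Lemma mutually_independent_sup X (t : seq I) : uniq t ->
  (forall s B, uniq (t ++ s) -> (forall i, measurable (B i)) ->
     P (cylinder X (t ++ s) B) = (\prod_(i <- t ++ s) P (X i @^-1` B i))%E) ->
  mutually_independent X.
Proof.
move=> ut Xt s B us mB.
pose B' i := if i \in s then B i else setT.
have mB' i : measurable (B' i) by rewrite /B'; case: ifP => // /mB.
pose s' := [seq i <- s | i \notin t].
have uts : uniq (t ++ s').
  rewrite cat_uniq ut filter_uniq // andbT /=.
  by apply/hasPn => i; rewrite mem_filter => /andP[].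
have smem i : i \in s -> i \in t ++ s'.
  by move=> si; rewrite mem_cat mem_filter si andbT orbN.
have -> : [set w | forall i, i \in s -> X i w \in B i] =
    cylinder X (t ++ s') B'.
  apply/seteqP; split => w /= wB i.
    by move=> _; rewrite /B'; case: ifP => [/wB //|_]; rewrite in_setT.
  by move=> si; have := wB i (smem i si); rewrite /B' si.
rewrite Xt //.
rewrite (bigID (mem s)) /= [X in (_ * X)%E]big1 ?mule1; last first.
  move=> i /negbTE si; rewrite /B' si preimage_setT; exact: probability_setT.
rewrite -big_filter (perm_big s) /=.
  by rewrite big_seq [RHS]big_seq; apply: eq_bigr => i si; rewrite /B' si.
apply: uniq_perm => //; first exact: filter_uniq.
move=> i; rewrite mem_filter.
by apply/andP/idP => [[]|si] //; split => //; apply: smem.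
Qed.

Lemma measurable_corner_flip X p q r i :
  measurable_fun setT (fun w => corner_flip p q r (X^~ w) i).
Proof.
have mX j : measurable_fun setT (X j) by exact: measurable_funPT.
rewrite /corner_flip; case: (i == p); last case: (i == q); last case: (i == r) => //.
- apply: measurable_funD => //; apply: measurable_maxr => //.
  exact: measurable_funB.
- apply: measurable_funD => //; apply: measurable_maxr => //.
  exact: measurable_funB.
- exact: measurable_minr.
Qed.

Definition flip_rv p q r X : I -> {RV P >-> R} :=
  fun i => rv P (measurable_corner_flip X p q r i).

#[local] Arguments flip_rv : simpl never.

Variables (al be : R) (p q r : I) (X : I -> {RV P >-> R}).
Hypotheses (al0 : 0 < al) (be0 : 0 < be) (ab : al + be = 1).
Hypotheses (pq : p != q) (pr : p != r) (qr : q != r).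
Hypothesis Xindep : mutually_independent X.
Hypothesis Xp : exponential_law al (distribution P (X p)).
Hypothesis Xq : exponential_law be (distribution P (X q)).
Hypothesis Xr : exponential_law 1 (distribution P (X r)).

Let V : {RV P >-> ((R * R) * R)%type} := rv_pair X (rv_pair X (X p) q) r.

Let flip_set (B1 B2 B3 : set R) : set ((R * R) * R) :=
  [set v | [/\ B1 (v.2 + Num.max (v.1.1 - v.1.2) 0),
               B2 (v.2 + Num.max (v.1.2 - v.1.1) 0) &
               B3 (Num.min v.1.1 v.1.2)]].

Let flip_indic (B1 B2 B3 : set R) v : \bar R :=
  ((\1_B1 (v.2 + Num.max (v.1.1 - v.1.2) 0)%R)%:E *
   (\1_B2 (v.2 + Num.max (v.1.2 - v.1.1) 0)%R)%:E *
   (\1_B3 (Num.min v.1.1 v.1.2))%:E)%E.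

Let indic_flip_set B1 B2 B3 v :
  (\1_(flip_set B1 B2 B3) v)%:E = flip_indic B1 B2 B3 v.
Proof.
rewrite /flip_indic -!EFinM; congr (_%:E); rewrite !indicE -!natrM !mulnb.
congr (_%:R); congr nat_of_bool; apply/idP/andP => [/set_mem[b1 b2 b3]|].
  by rewrite !mem_set.
by move=> [/andP[/set_mem b1 /set_mem b2] /set_mem b3]; apply: mem_set.
Qed.

Let measurable_flip_indic B1 B2 B3 :
  measurable B1 -> measurable B2 -> measurable B3 ->
  measurable_fun setT (flip_indic B1 B2 B3).
Proof.
move=> mB1 mB2 mB3.
have m11 : measurable_fun setT (fun v : (R * R) * R => v.1.1).
  exact: measurableT_comp.
have m12 : measurable_fun setT (fun v : (R * R) * R => v.1.2).
  exact: measurableT_comp.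
apply: emeasurable_funM; first apply: emeasurable_funM;
  apply: measurable_indic_comp => //.
- apply: measurable_funD => //; apply: measurable_maxr => //.
  exact: measurable_funB.
- apply: measurable_funD => //; apply: measurable_maxr => //.
  exact: measurable_funB.
- exact: measurable_minr.
Qed.

Let measurable_flip_set B1 B2 B3 :
  measurable B1 -> measurable B2 -> measurable B3 ->
  measurable (flip_set B1 B2 B3).
Proof.
move=> mB1 mB2 mB3; apply/(measurable_indicP R).
apply/measurable_EFinP; apply: eq_measurable_fun (measurable_flip_indic mB1 mB2 mB3).
by move=> v _; rewrite -indic_flip_set.
Qed.

Let V_off : independent_off X [:: r; q; p] V.
Proof.
apply: independent_off_pair => //; last first.
  by rewrite !inE negb_or ![r == _]eq_sym qr pr.
apply: independent_off_pair => //; last by rewrite inE eq_sym.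
exact: independent_off1.
Qed.

(** The triple has a product law, so the probability is the iterated integral computed in
    [corner_flip_law]. *)
Let V_law B1 B2 B3 : measurable B1 -> measurable B2 -> measurable B3 ->
  P (V @^-1` flip_set B1 B2 B3) =
  (P (X p @^-1` B1) * P (X q @^-1` B2) * P (X r @^-1` B3))%E.
Proof.
move=> mB1 mB2 mB3.
have off1 : independent_off X [:: p] (X p) by exact: independent_off1.
have off2 : independent_off X [:: q; p] (rv_pair X (X p) q).
  by apply: independent_off_pair => //; rewrite inE eq_sym.
have mE := measurable_flip_set mB1 mB2 mB3.
have mF := measurable_flip_indic mB1 mB2 mB3.
have F0 v : (0 <= flip_indic B1 B2 B3 v)%E by rewrite -indic_flip_set lee_fin.
have qp : q \notin [:: p] by rewrite inE eq_sym.
have rqp : r \notin [:: q; p] by rewrite !inE negb_or ![r == _]eq_sym qr pr.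
have G0 z : (0 <= \int[distribution P (X r)]_w flip_indic B1 B2 B3 (z, w))%E.
  by apply: integral_ge0.
have mG : measurable_fun setT (fun z : R * R =>
    \int[distribution P (X r)]_w flip_indic B1 B2 B3 (z, w))%E.
  exact: measurable_fun_fubini_tonelli_F.
rewrite (rv_pair_law Xindep off2 rqp mE) -[LHS]mul1e.
transitivity (\int[distribution P (rv_pair X (X p) q)]_z
    \int[distribution P (X r)]_w flip_indic B1 B2 B3 (z, w))%E.
  rewrite mul1e -fubini_tonelli1 // -[flip_set _ _ _ in LHS]setIT.
  rewrite -integral_indic //; apply: eq_integral => v _.
  exact: indic_flip_set.
transitivity (\int[distribution P (X p) \x distribution P (X q)]_z
    \int[distribution P (X r)]_w flip_indic B1 B2 B3 (z, w))%E.
  apply: eq_measure_integral => A mA _.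
  exact: (rv_pair_law Xindep off1 qp mA).
rewrite fubini_tonelli1 //.
rewrite -[RHS](corner_flip_law al0 be0 ab Xp Xq Xr mB1 mB2 mB3).
by apply: eq_integral => x _; apply: eq_integral => y _; apply: eq_integral.
Qed.

Let flip_rvE w : [/\ flip_rv p q r X p w = X r w + Num.max (X p w - X q w) 0,
  flip_rv p q r X q w = X r w + Num.max (X q w - X p w) 0,
  flip_rv p q r X r w = Num.min (X p w) (X q w) &
  forall i, i \notin [:: p; q; r] -> flip_rv p q r X i w = X i w].
Proof.
rewrite /flip_rv /= /corner_flip !eqxx [q == p]eq_sym (negbTE pq).
rewrite ![r == _]eq_sym (negbTE pr) (negbTE qr); split => // i.
by rewrite !inE !negb_or => /and3P[/negbTE -> /negbTE -> /negbTE ->].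
Qed.

Let flip_preimage B1 B2 B3 :
  flip_rv p q r X p @^-1` B1 `&` flip_rv p q r X q @^-1` B2 `&`
    flip_rv p q r X r @^-1` B3 = V @^-1` flip_set B1 B2 B3.
Proof.
apply/seteqP; split => w; have [e1 e2 e3 _] := flip_rvE w.
  by rewrite /setI /preimage /mkset e1 e2 e3 => -[[]].
by rewrite /setI /preimage /mkset e1 e2 e3 => -[].
Qed.

Lemma flip_rv_law i B : measurable B ->
  P (flip_rv p q r X i @^-1` B) = P (X i @^-1` B).
Proof.
move=> mB.
have [->|ip] := eqVneq i p.
  have := @V_law B setT setT mB measurableT measurableT.
  by rewrite -flip_preimage !preimage_setT !setIT !probability_setT !mule1.
have [->|iq] := eqVneq i q.
  have := @V_law setT B setT measurableT mB measurableT.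
  by rewrite -flip_preimage !preimage_setT setIT setTI !probability_setT mule1 mul1e.
have [->|ir] := eqVneq i r.
  have := @V_law setT setT B measurableT measurableT mB.
  by rewrite -flip_preimage !preimage_setT !setTI !probability_setT !mul1e.
congr (P _); apply/seteqP; split => w; have [_ _ _ e] := flip_rvE w;
  by rewrite /preimage /mkset e // !inE !negb_or ip iq.
Qed.

(** Only the sites [p], [q], [r] change, and their new values are functions of [V], which is
    independent of the other sites; among the three, [V_law] is the product rule. *)
Lemma flip_rv_independent : mutually_independent (flip_rv p q r X).
Proof.
apply: (@mutually_independent_sup _ [:: p; q; r]).
  by rewrite /= !inE negb_or pq pr qr.
move=> s B uniqs mB; have := uniqs.
rewrite [uniq _]/= !inE !negb_or => /and4P[/and3P[_ _ ps] /andP[_ qs] rs us].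
rewrite [(_ ++ _)%SEQ]/= !big_cons.
have off i : i \in s -> i \notin [:: p; q; r].
  by move=> si; rewrite !inE !negb_or; apply/and3P; split;
    apply: contraTneq si => ->.
have sE : cylinder (flip_rv p q r X) s B = cylinder X s B.
  apply/seteqP; split => w wB i si; move: (wB i si);
    by have [_ _ _ -> //] := flip_rvE w; apply: off.
rewrite !cylinder_cons sE !setIA flip_preimage setIC V_off //; last 2 first.
- by move=> i /off; rewrite !inE !negb_or => /and3P[-> -> ->].
- exact: measurable_flip_set.
rewrite probability_cylinder // V_law // muleC.
rewrite [in RHS](eq_big_seq (fun i => P (X i @^-1` B i))); last first.
  move=> i si; congr (P _); apply/seteqP; split => w;
    have [_ _ _ e] := flip_rvE w; by rewrite /preimage /mkset e ?off.
by rewrite !flip_rv_law // !muleA.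
Qed.

End FlipFamily.

(** * Concentration *)

Section ExponentialSums.
Context (R : realType) (d : measure_display) (Omega : measurableType d).
Variables (P : probability Omega R) (I : choiceType) (X : I -> {RV P >-> R}).
Hypothesis Xindep : mutually_independent X.

Lemma measurable_sum_rv (t : seq I) :
  measurable_fun setT (fun w => \sum_(i <- t) X i w).
Proof. by apply: measurable_sum => i; exact: measurable_funPT. Qed.

Lemma sum_rv_off (t : seq I) : uniq t ->
  independent_off X t (rv P (measurable_sum_rv t)).
Proof.
elim: t => [_|i t IH /andP[it /IH {}IH]].
  apply: (independent_off_comp (V := rv P (measurable_cst (0 : R)))
    (f := idfun)).
  - exact: measurable_id.
  - exact: independent_off_cst.
  - by move=> w /=; rewrite big_nil.
apply: (independent_off_comp (V := rv_pair X (rv P (measurable_sum_rv t)) i)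
  (f := fun z : R * R => z.1 + z.2)).
- by apply: measurable_funD.
- exact: independent_off_pair.
- by move=> w /=; rewrite big_cons addrC.
Qed.

Lemma sum_rv_mmt_gen (l c : R) (t : seq I) : 0 < l -> c < l -> uniq t ->
  (forall i, i \in t -> exponential_law l (distribution P (X i))) ->
  (\int[P]_w (expR (c * \sum_(i <- t) X i w))%:E =
    ((l / (l - c)) ^+ size t)%:E)%E.
Proof.
move=> l0 cl; elim: t => [_ _|i t IH].
  under eq_integral do rewrite big_nil mulr0 expR0.
  rewrite integral_cst // mul1e expr0; exact: probability_setT.
rewrite cons_uniq => /andP[it ut] tl.
set S := rv P (measurable_sum_rv t).
pose g (z : R * R) : \bar R := ((expR (c * z.1))%:E * (expR (c * z.2))%:E)%E.
have mexp : measurable_fun setT (fun x : R => (expR (c * x))%:E : \bar R).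
  apply/measurable_EFinP; apply: measurableT_comp => //; exact: measurable_funM.
have mg : measurable_fun setT g.
  by apply: emeasurable_funM;
    [exact: (measurableT_comp mexp measurable_fst)|
     exact: (measurableT_comp mexp measurable_snd)].
have g0 z : (0 <= g z)%E by rewrite mule_ge0 // lee_fin expR_ge0.
transitivity (\int[P]_w g (rv_pair X S i w))%E.
  apply: eq_integral => w _; rewrite /g /= -EFinM -expRD -mulrDr.
  by rewrite big_cons addrC.
transitivity (\int[distribution P (rv_pair X S i)]_z g z)%E.
  by rewrite ge0_integral_distribution.
transitivity (\int[distribution P S \x distribution P (X i)]_z g z)%E.
  apply: eq_measure_integral => A mA _.
  exact: (rv_pair_law Xindep (sum_rv_off ut) it mA).
rewrite fubini_tonelli1 // /fubini_F /g /=.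
have Ei : (\int[distribution P (X i)]_y (expR (c * y))%:E =
    (l / (l - c))%:E)%E.
  by apply: exponential_law_mmt_gen => //; apply: tl; rewrite mem_head.
have e0 (x : R) : (0 <= (expR (c * x))%:E)%E by rewrite lee_fin expR_ge0.
under eq_integral do rewrite ge0_integralZl // Ei.
rewrite ge0_integralZr //; last by rewrite lee_fin divr_ge0 ?ltW ?subr_gt0.
have -> : (\int[distribution P S]_x (expR (c * x))%:E =
    \int[P]_w (expR (c * \sum_(j <- t) X j w))%:E)%E.
  by rewrite ge0_integral_distribution // => x; rewrite lee_fin expR_ge0.
rewrite IH //; last by move=> j jt; apply: tl; rewrite inE jt orbT.
by rewrite -EFinM exprSr.
Qed.

(** The sign of [c] selects the tail: positive for the upper, negative for the lower one. *)
Lemma sum_rv_chernoff (l c a : R) (t : seq I) : 0 < l -> c < l -> uniq t ->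
  (forall i, i \in t -> exponential_law l (distribution P (X i))) ->
  (P [set w | (a <= c * \sum_(i <- t) X i w)%R]
     <= (expR (- a) * (l / (l - c)) ^+ size t)%:E)%E.
Proof.
move=> l0 cl ut tl; rewrite mulrC EFinM -(sum_rv_mmt_gen l0 cl ut tl).
have mcS : measurable_fun setT (fun w => c * \sum_(i <- t) X i w).
  by apply: measurable_funM => //; exact: measurable_sum_rv.
have ME (Y : {RV P >-> R}) : ('M_P Y 1 = \int[P]_w (expR (Y w))%:E)%E.
  by rewrite /mmt_gen_fun unlock; apply: eq_integral => w _ /=; rewrite mulr1.
by have := chernoff (rv P mcS) a ltr01; rewrite mul1r ME.
Qed.

End ExponentialSums.

(** * Events of exponentially small probability *)

Section ExponentiallyLikely.
Context (R : realType) (d : measure_display) (Omega : measurableType d).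
Variable P : probability Omega R.

Definition exponentially_small (B : nat -> set Omega) :=
  exists C q : R, [/\ 0 <= C, 0 <= q, q < 1 &
    forall k, (P (B k) <= (C * q ^+ k)%:E)%E].

(** Covering the failures of [Q k] by a measurable [B k] keeps measurability of the predicates
    themselves out of the argument. *)
Definition exponentially_likely (Q : nat -> Omega -> Prop) :=
  exists B, [/\ forall k, measurable (B k), exponentially_small B &
    forall k w, ~ B k w -> Q k w].

Lemma exponentially_smallU (B1 B2 : nat -> set Omega) :
  (forall k, measurable (B1 k)) -> (forall k, measurable (B2 k)) ->
  exponentially_small B1 -> exponentially_small B2 ->
  exponentially_small (fun k => B1 k `|` B2 k).
Proof.
move=> m1 m2 [C1 [q1 [C10 q10 q11 b1]]] [C2 [q2 [C20 q20 q21 b2]]].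
exists (C1 + C2), (Num.max q1 q2); split.
- exact: addr_ge0.
- by rewrite le_max q10.
- by rewrite gt_max q11.
move=> k; apply: (le_trans (measureU2 _ (m1 k) (m2 k))).
rewrite mulrDl EFinD; apply: leeD.
- by rewrite (le_trans (b1 k)) // lee_fin ler_wpM2l // lerXn2r ?nnegrE ?le_max
    ?lexx ?q10.
- by rewrite (le_trans (b2 k)) // lee_fin ler_wpM2l // lerXn2r ?nnegrE ?le_max
    ?lexx ?q20 ?orbT.
Qed.

Lemma exponentially_likely_imply (Q1 Q2 : nat -> Omega -> Prop) :
  (forall k w, Q1 k w -> Q2 k w) ->
  exponentially_likely Q1 -> exponentially_likely Q2.
Proof.
by move=> Q12 [B [mB sB BQ]]; exists B; split => // k w /BQ; exact: Q12.
Qed.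

Lemma exponentially_likely_and (Q1 Q2 : nat -> Omega -> Prop) :
  exponentially_likely Q1 -> exponentially_likely Q2 ->
  exponentially_likely (fun k w => Q1 k w /\ Q2 k w).
Proof.
move=> [B1 [m1 s1 b1]] [B2 [m2 s2 b2]]; exists (fun k => B1 k `|` B2 k); split.
- by move=> k; exact: measurableU.
- exact: exponentially_smallU.
- by move=> k w /not_orP[/b1 ? /b2].
Qed.

Lemma exponentially_likely_bounded (Q : nat -> nat -> Omega -> Prop) n :
  (forall a, exponentially_likely (Q a)) ->
  exponentially_likely (fun k w => forall a, (a <= n)%N -> Q a k w).
Proof.
move=> LQ; elim: n => [|n IH].
  by apply: exponentially_likely_imply (LQ 0%N) => k w Q0 a; case: a.
apply: exponentially_likely_imply (exponentially_likely_and (LQ n.+1) IH).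
by move=> k w [Qn Qs] a; rewrite leq_eqVlt => /orP[/eqP->|/Qs].
Qed.

(** The numerator decreases linearly in [s], whereas the denominator differs from 1 only by
    O(s^2). *)
Lemma small_exponential_rate (x : R) (b : nat) : 0 < x ->
  exists2 s : R, 0 < s < 1 & expR (- (s * x)) / (1 - s ^+ 2) ^+ b < 1.
Proof.
(* This choice yields [b s (1 + s x) <= x / 2], whence [(1 + s x) (1 - b s^2) > 1]. *)
move=> x0; pose n : R := b.+1%:R; pose s := Num.min (2^-1) (x / (2 * n * (1 + x))).
have n0 : 0 < n by rewrite ltr0n.
have D0 : 0 < 2 * n * (1 + x) by rewrite !mulr_gt0 // addr_gt0.
have s0 : 0 < s by rewrite lt_min divr_gt0 // invr_gt0 ltr0n.
have s2 : s <= 2^-1 by rewrite ge_min lexx.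
have sx : s * (2 * n * (1 + x)) <= x.
  by rewrite -ler_pdivlMr // ge_min lexx orbT.
exists s; first by rewrite s0 (le_lt_trans s2) // invf_lt1 ?ltr0n // ltr1n.
have s21 : 0 < 1 - s ^+ 2 by nra.
rewrite ltr_pdivrMr ?exprn_gt0 // mul1r expRN.
have e1 : 1 + s * x <= expR (s * x) by exact: expR_ge1Dx.
(* Bernoulli's inequality. *)
have p1 : 1 - b%:R * s ^+ 2 <= (1 - s ^+ 2) ^+ b.
  elim: (b) => [|m IH]; first by rewrite mul0r subr0 expr0.
  rewrite [leRHS]exprS -natr1.
  have m0 : 0 <= m%:R :> R by rewrite ler0n.
  have : (1 - s ^+ 2) * (1 - m%:R * s ^+ 2) <= (1 - s ^+ 2) * (1 - s ^+ 2) ^+ m.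
    by rewrite ler_pM2l.
  have : 0 <= m%:R * (s ^+ 2 * s ^+ 2).
    by apply: mulr_ge0 => //; apply: mulr_ge0; exact: sqr_ge0.
  move=> ??; nra.
apply: (lt_le_trans _ p1).
have sx0 : 0 < s * x by rewrite mulr_gt0.
have le1 : (expR (s * x))^-1 <= (1 + s * x)^-1.
  by rewrite lef_pV2 ?posrE ?expR_gt0 // addr_gt0.
apply: (le_lt_trans le1); rewrite -[_^-1]mul1r ltr_pdivrMr ?addr_gt0 //.
have bn : b%:R <= n by rewrite ler_nat.
have b0 : 0 <= b%:R :> R by rewrite ler0n.
have s1x : 1 + s * x <= 1 + x by nra.
have : 2 * (s * (b%:R * (1 + s * x))) <= x.
  apply: le_trans sx; rewrite mulrCA -mulrA !ler_pM2l //.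
  by rewrite ler_pM // addr_ge0 // ltW.
move=> h; have : s * (2 * (s * (b%:R * (1 + s * x)))) <= s * x by rewrite ler_pM2l.
nra.
Qed.

End ExponentiallyLikely.

(** * Concentration of sums of exponential variables *)

Section Concentration.
Context (R : realType) (d : measure_display) (Omega : measurableType d).
Variable P : probability Omega R.

Lemma measurable_ge_rv (a : R) (f : Omega -> R) : measurable_fun setT f ->
  measurable [set w | a <= f w].
Proof.
move=> mf; have -> : [set w | a <= f w] = f @^-1` `[a, +oo[%classic.
  by apply/seteqP; split => w /=; rewrite in_itv /= andbT.
by rewrite -[_ @^-1` _]setTI; apply: mf.
Qed.

(** Chernoff's bound with parameter [r * l], where [r] is [s] or [- s] according to the tail. Both
    signs share one rate because [1 + r <= expR r] gives
    [expR (- r) / (1 - r) <= 1 / (1 - r ^+ 2)]. *)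
Lemma sum_rv_tail (I : choiceType) (X : I -> {RV P >-> R}) (t : seq I)
    (l s r x : R) (k b : nat) :
  0 < l -> 0 < s < 1 -> s ^+ 2 = r ^+ 2 -> mutually_independent X -> uniq t ->
  (forall i, i \in t -> exponential_law l (distribution P (X i))) ->
  size t = (k * b)%N ->
  (P [set w | (r * (k * b)%:R + s * x * k%:R <= r * l * \sum_(i <- t) X i w)%R]
    <= ((expR (- (s * x)) / (1 - s ^+ 2) ^+ b) ^+ k)%:E)%E.
Proof.
move=> l0 /andP[s0 s1] sr Xi ut tl st.
have r2 : r ^+ 2 < 1 by rewrite -sr expr_lt1 // ltW.
have r11 : -1 < r < 1 by nra.
have /andP[r0 r1] := r11.
have cl : r * l < l by nra.
have := sum_rv_chernoff Xi (r * (k * b)%:R + s * x * k%:R) l0 cl ut tl.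
move=> /le_trans; apply; rewrite lee_fin st.
have lE : l / (l - r * l) = (1 - r)^-1.
  by rewrite -[X in _ / (X - _)]mul1r -mulrBl invfM mulrCA divff ?gt_eqF // mulr1.
have eE : - (r * (k * b)%:R + s * x * k%:R) = k%:R * (- (s * x) + b%:R * - r).
  by rewrite natrM; ring.
rewrite lE eE expRM_natl expRD expRM_natl mulnC exprM -exprMn -mulrA -exprMn.
have core0 : 0 <= expR (- r) * (1 - r)^-1.
  by rewrite mulr_ge0 ?expR_ge0 // invr_ge0 subr_ge0 ltW.
have core : expR (- r) * (1 - r)^-1 <= (1 - s ^+ 2)^-1.
  rewrite sr expRN -invfM lef_pV2 ?posrE ?mulr_gt0 ?expR_gt0 ?subr_gt0 //.
  have -> : 1 - r ^+ 2 = (1 + r) * (1 - r) by ring.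
  by rewrite ler_pM2r ?subr_gt0 //; exact: expR_ge1Dx.
have core' : 0 <= (1 - s ^+ 2)^-1 by exact: le_trans core0 core.
rewrite -exprVn; apply: lerXn2r; rewrite ?nnegrE ?mulr_ge0 ?exprn_ge0 ?expR_ge0 //.
apply: ler_wpM2l; first exact: expR_ge0.
by apply: lerXn2r; rewrite ?nnegrE.
Qed.

(** The family is allowed to vary with [k] because the sweep that computes the passage time to
    [(k * a, k * b)] does. *)
Lemma sum_rv_concentration (I : choiceType) (X : nat -> I -> {RV P >-> R})
    (t : nat -> seq I) (l eps : R) (b : nat) :
  0 < l -> 0 < eps -> (forall k, mutually_independent (X k)) ->
  (forall k, uniq (t k)) -> (forall k, size (t k) = (k * b)%N) ->
  (forall k i, i \in t k -> exponential_law l (distribution P (X k i))) ->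
  exponentially_likely P (fun k w =>
    `|\sum_(i <- t k) X k i w - k%:R * (b%:R / l)| <= eps * k%:R).
Proof.
move=> l0 eps0 Xi ut st tl.
have [s s01 q1] := small_exponential_rate b (mulr_gt0 l0 eps0).
have /andP[s0 s1] := s01.
set q := _ / _ in q1.
have q0 : 0 <= q.
  rewrite divr_ge0 ?expR_ge0 ?exprn_ge0 // subr_ge0 ltW // expr_lt1 //.
  exact: ltW.
pose B (r : R) k := [set w | (r * (k * b)%:R + s * (l * eps) * k%:R <=
  r * l * \sum_(i <- t k) X k i w)%R].
have mB r k : measurable (B r k).
  apply: measurable_ge_rv; apply: measurable_funM => //.
  exact: measurable_sum_rv.
have sB r : s ^+ 2 = r ^+ 2 -> exponentially_small P (B r).
  move=> sr; exists 1, q; split => // k; rewrite mul1r.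
  by apply: sum_rv_tail; rewrite ?st //; exact: tl.
exists (fun k => B s k `|` B (- s) k); split.
- by move=> k; exact: measurableU.
- by apply: exponentially_smallU => //; apply: sB; rewrite ?sqrrN.
move=> k w /not_orP[]; rewrite /B /= => /negP; rewrite -ltNge => lt1.
move=> /negP; rewrite -ltNge => lt2.
rewrite ler_norml; move: lt1 lt2; set S := \sum_(i <- t k) _ => lt1 lt2.
have E : k%:R * (b%:R / l) = (k * b)%:R / l by rewrite natrM mulrA.
have sl : 0 < s * l by exact: mulr_gt0.
rewrite E; set N : R := (k * b)%:R in lt1 lt2 *.
have NE : s * N = s * l * (N / l) by rewrite -mulrA [l * _]mulrC divfK // gt_eqF.
apply/andP; split; rewrite -(ler_pM2l sl); apply/ltW; nra.
Qed.

Lemma exponential_rv_likely (X : {RV P >-> R}) (eps : R) : 0 < eps ->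
  exponential_law 1 (distribution P X) ->
  exponentially_likely P (fun k w => X w <= eps * k%:R).
Proof.
move=> eps0 Xe.
(* A single variable is viewed as a sum with one term; Chernoff's bound at [c = 1 / 2] then has
   prefactor 2. *)
pose Y := fun _ : unit => X.
have Yi : mutually_independent Y.
  move=> [|[] [|[] s]] B //= _ mB.
    rewrite big_nil; have -> : [set w | forall i, i \in [::] -> Y i w \in B i] = setT.
      by apply/seteqP; split.
    exact: probability_setT.
  rewrite big_seq1; congr (P _); apply/seteqP; split => w /= wB.
    by apply: set_mem; apply: (wB tt).
  by move=> [] _; apply: mem_set.
have h0 : 0 < 2^-1 :> R by rewrite invr_gt0.
have h1 : 2^-1 < 1 :> R by rewrite invf_lt1 // ltr1n.
exists (fun k => [set w | 2^-1 * (eps * k%:R) <= 2^-1 * \sum_(i <- [:: tt]) Y i w]).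
split.
- move=> k; apply: measurable_ge_rv; apply: measurable_funM => //.
  exact: measurable_sum_rv.
- exists 2, (expR (- (2^-1 * eps))); split => //.
  + by rewrite expR_lt1 oppr_lt0 mulr_gt0.
  move=> k; apply: (le_trans (sum_rv_chernoff Yi _ ltr01 h1 _ _)) => //.
  have -> : - (2^-1 * (eps * k%:R)) = k%:R * - (2^-1 * eps) by ring.
  have -> : 1 / (1 - 2^-1) = 2 :> R by field.
  by rewrite expRM_natl expr1 mulrC.
move=> k w /negP; rewrite -ltNge big_seq1 ltr_pM2l // => /ltW //.
Qed.

(** Negativity at some index is a countable union of null events. Stating the result as
    exponentially likely, although the event is constant in [k], lets it be combined with the other
    bounds. *)
Lemma exponential_rv_ge0 (I : countType) (X : I -> {RV P >-> R}) (l : I -> R) :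
  (forall i, 0 < l i) ->
  (forall i, exponential_law (l i) (distribution P (X i))) ->
  exponentially_likely P (fun k w => forall i, 0 <= X i w).
Proof.
move=> l0 Xl.
pose N i := X i @^-1` `]-oo, 0[%classic.
have mN i : measurable (N i) by apply: measurable_rv_preimage.
have N0 i : P (N i) = 0%E.
  transitivity (distribution P (X i) `]-oo, 0[%classic) => //.
  rewrite Xl // /exponential_prob integral0_eq // => x /=.
  by rewrite in_itv /= => x0; rewrite lt0_exponential_pdf.
pose B := \bigcup_n (if unpickle n is Some i then N i else set0).
have mB : measurable B.
  by apply: bigcupT_measurable => n; case: unpickle.
exists (fun=> B); split => //.
  exists 0, 0; split => // k; rewrite mul0r.
  have -> : P B = 0%E; last by [].
  apply/(negligibleP _ mB)/negligible_bigcup => n.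
  case: unpickle => [i|]; last exact: negligible_set0.
  by apply/(negligibleP _ (mN i)); exact: N0.
move=> k w Bw i; rewrite leNgt; apply/negP => Xw; apply: Bw.
by exists (pickle i) => //; rewrite pickleK /N /= in_itv.
Qed.

End Concentration.

(** * The stationary model *)

Section Stationary.
Context (R : realType) (d : measure_display) (Omega : measurableType d).
Variable P : probability Omega R.

Lemma measurable_scale_rv (c : R) (X : {RV P >-> R}) :
  measurable_fun setT (fun w => c * X w).
Proof. by apply: measurable_funM => //; exact: measurable_funPT. Qed.

Lemma mutually_independent_scale (I : choiceType) (X Y : I -> {RV P >-> R})
    (c : I -> R) : (forall i w, Y i w = c i * X i w) ->
  mutually_independent X -> mutually_independent Y.
Proof.
move=> YX Xi s B us mB.
have YB i A : Y i @^-1` A = X i @^-1` ((fun x => c i * x) @^-1` A).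
  by apply/seteqP; split => w /=; rewrite YX.
under eq_bigr do rewrite YB.
rewrite -(Xi s (fun i => (fun x => c i * x) @^-1` B i)) //.
  congr (P _); apply/seteqP; split => w wB i si; move: (wB i si);
    by rewrite !in_setE /= YX.
move=> i si; rewrite -[_ @^-1` _]setTI; apply: measurable_funM => //.
exact: mB.
Qed.

Lemma exponential_law_scale (c : R) (X Y : {RV P >-> R}) : 0 < c ->
  (forall w, Y w = c * X w) -> exponential_law 1 (distribution P X) ->
  exponential_law c^-1 (distribution P Y).
Proof.
move=> c0 YX Xe B mB.
have mcB : measurable ((fun x : R => c * x) @^-1` B).
  by rewrite -[_ @^-1` _]setTI; apply: measurable_funM.
transitivity (distribution P X ((fun x : R => c * x) @^-1` B)).
  by congr (P _); apply/seteqP; split => w /=; rewrite YX.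
transitivity (exponential_prob 1 ((fun x : R => c * x) @^-1` B)).
  exact: Xe.
rewrite /exponential_prob integral_mkcond [RHS]integral_mkcond.
have mpdf k : measurable_fun setT (fun x : R => (exponential_pdf k x)%:E).
  by apply/measurable_EFinP; exact: measurable_exponential_pdf.
rewrite [RHS](@ge0_integral_affine _ c 0) //; last 2 first.
- apply/(measurable_restrictT _ _).1 => //.
  exact: measurable_funTS.
- move=> x; rewrite patchE; case: ifP => // _.
  by rewrite lee_fin exponential_pdf_ge0 // invr_ge0 ltW.
rewrite -ge0_integralZl //; last 3 first.
- apply: (measurableT_comp (f := (fun x : R => (exponential_pdf c^-1 x)%:E) \_ B)).
    by apply/(measurable_restrictT _ _).1 => //; exact: measurable_funTS.
  by apply: measurable_funD => //; exact: measurable_funM.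
- move=> x _; rewrite patchE; case: ifP => // _.
  by rewrite lee_fin exponential_pdf_ge0 // invr_ge0 ltW.
- by rewrite lee_fin ltW.
apply: eq_integral => x _; rewrite addr0 !patchE.
have -> : (x \in (fun x : R => c * x) @^-1` B) = (c * x \in B).
  by apply/idP/idP => /set_mem ?; exact: mem_set.
case: ifP => _; last by rewrite mule0.
rewrite -EFinM !exponential_pdf_if pmulr_rge0 //; case: ifP => _; last by rewrite mulr0.
rewrite mulrA divff ?gt_eqF //; congr (_ * expR _)%:E.
by rewrite !mulNr mulrA mulVf ?gt_eqF.
Qed.

Fixpoint flip_column_rv (i j : nat) (X : nat * nat -> {RV P >-> R}) :=
  if j is j'.+1 then flip_rv (i, 0)%N (0, j)%N (i, j) (flip_column_rv i j' X)
  else X.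

Fixpoint flip_columns_rv (i n : nat) (X : nat * nat -> {RV P >-> R}) :=
  if i is i'.+1 then flip_column_rv i n (flip_columns_rv i' n X) else X.

Lemma flip_column_rvE i j X w z :
  flip_column_rv i j X z w = flip_column i j (X^~ w) z.
Proof.
elim: j z => [|j IH] z //=; congr (corner_flip _ _ _ _ z).
by apply/funext => y; exact: IH.
Qed.

Lemma flip_columns_rvE i n X w z :
  flip_columns_rv i n X z w = flip_columns i n (X^~ w) z.
Proof.
elim: i z => [|i IH] z //=; rewrite flip_column_rvE; congr (flip_column _ _ _ z).
by apply/funext => y; exact: IH.
Qed.

(** [al] and [be] are rates, the inverses of the axis multipliers. No law is prescribed at the
    origin, which no flip involves. *)
Definition stationary_weights (al be : R) (X : nat * nat -> {RV P >-> R}) :=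
  [/\ mutually_independent X,
      forall i, exponential_law al (distribution P (X (i.+1, 0)%N)),
      forall j, exponential_law be (distribution P (X (0, j.+1)%N)) &
      forall i j, exponential_law 1 (distribution P (X (i.+1, j.+1)))].

Lemma stationary_flip_columns al be X m n : 0 < al -> 0 < be -> al + be = 1 ->
  stationary_weights al be X ->
  stationary_weights al be (flip_columns_rv m n X).
Proof.
move=> al0 be0 ab SX.
have step i j Y : stationary_weights al be Y ->
    stationary_weights al be
      (flip_rv (i.+1, 0)%N (0, j.+1)%N (i.+1, j.+1) Y).
  move=> [Yi Yh Yv Yw].
  have pr : (i.+1, 0)%N != (i.+1, j.+1) by rewrite xpair_eqE andbF.
  have pq : (i.+1, 0)%N != (0, j.+1)%N by [].
  have qr : (0, j.+1)%N != (i.+1, j.+1) by [].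
  have law z B : measurable B ->
      distribution P (flip_rv (i.+1, 0)%N (0, j.+1)%N (i.+1, j.+1) Y z) B =
      distribution P (Y z) B.
    exact: (flip_rv_law al0 be0 ab pq pr qr Yi (Yh i) (Yv j) (Yw i j)).
  split.
  - exact: (flip_rv_independent al0 be0 ab pq pr qr Yi (Yh i) (Yv j) (Yw i j)).
  - by move=> k B mB; rewrite law // Yh.
  - by move=> k B mB; rewrite law // Yv.
  - by move=> k l B mB; rewrite law // Yw.
elim: m => [//|m IH] /=; elim: n (flip_columns_rv m n X) IH => [//|n IHn] Y SY.
by apply: step; exact: IHn.
Qed.

(** By [lpp_flip_columns] the passage time is the weight of the origin plus [k * a] independent
    weights of rate [al] plus [k * b] independent increments of rate [be]. A union bound gives each
    of the three terms a third of the error, with no independence between the two sums. *)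
Lemma lpp_stationary_concentration al be (X : nat * nat -> {RV P >-> R})
    (a b : nat) (eps : R) : 0 < al -> 0 < be -> al + be = 1 -> 0 < eps ->
  stationary_weights al be X ->
  exponential_law 1 (distribution P (X (0, 0)%N)) ->
  exponentially_likely P (fun k w => (forall z, 0 <= X z w) ->
    `|lpp (X^~ w) (k * a)%N (k * b)%N - k%:R * (a%:R / al + b%:R / be)|
      <= eps * k%:R).
Proof.
move=> al0 be0 ab eps0 SX X00.
have e3 : 0 < eps / 3 by rewrite divr_gt0.
have [Xi Xh _ _] := SX.
pose th k := [seq (l.+1, 0)%N | l <- iota 0 (k * a)].
pose tv k := [seq (0, l.+1)%N | l <- iota 0 (k * b)].
have uth k : uniq (th k) by rewrite map_inj_uniq ?iota_uniq // => x y [].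
have utv k : uniq (tv k) by rewrite map_inj_uniq ?iota_uniq // => x y [].
have Ch : exponentially_likely P (fun k w =>
    `|\sum_(i <- th k) X i w - k%:R * (a%:R / al)| <= eps / 3 * k%:R).
  apply: (sum_rv_concentration (X := fun=> X)) => // k; first by rewrite size_map size_iota.
  by move=> i /mapP[l _ ->].
have SV k := stationary_flip_columns (k * a) (k * b) al0 be0 ab SX.
have Cv : exponentially_likely P (fun k w =>
    `|\sum_(i <- tv k) flip_columns_rv (k * a) (k * b) X i w -
      k%:R * (b%:R / be)| <= eps / 3 * k%:R).
  apply: (sum_rv_concentration (X := fun k => flip_columns_rv (k * a) (k * b) X)) => // k.
  - by have [] := SV k.
  - by rewrite size_map size_iota.
  - by move=> i /mapP[l _ ->]; have [] := SV k.
have C0 := exponential_rv_likely e3 X00.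
apply: exponentially_likely_imply (exponentially_likely_and C0
  (exponentially_likely_and Ch Cv)) => k w [X0 [hh hv]] Xge0.
rewrite lpp_flip_columns.
have Eh : \sum_(l < k * a) X (l.+1, 0)%N w = \sum_(i <- th k) X i w.
  by rewrite big_map -(big_mkord xpredT (fun l => X (l.+1, 0)%N w)) /index_iota subn0.
have Ev : \sum_(l < k * b) flip_columns (k * a) (k * b) (X^~ w) (0, l.+1)%N =
    \sum_(i <- tv k) flip_columns_rv (k * a) (k * b) X i w.
  rewrite big_map -(big_mkord xpredT (fun l =>
    flip_columns (k * a) (k * b) (X^~ w) (0, l.+1)%N)) /index_iota subn0.
  by apply: eq_bigr => l _; rewrite flip_columns_rvE.
rewrite Eh Ev; move: hh hv X0 (Xge0 (0, 0)%N).
set x := X _ w; set H := \sum_(i <- th k) _; set V := \sum_(i <- tv k) _.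
rewrite !ler_norml mulrDr => /andP[h1 h2] /andP[v1 v2] x1 x2.
by apply/andP; split; lra.
Qed.

Lemma lpp_scale_axes_concentration (Y : nat * nat -> {RV P >-> R})
    (u v eps : R) (a b : nat) : 0 < u -> 0 < v -> u^-1 + v^-1 = 1 -> 0 < eps ->
  mutually_independent Y ->
  (forall z, exponential_law 1 (distribution P (Y z))) ->
  exponentially_likely P (fun k w => (forall z, 0 <= Y z w) ->
    `|lpp (scale_axes u v (Y^~ w)) (k * a)%N (k * b)%N -
      k%:R * (a%:R * u + b%:R * v)| <= eps * k%:R).
Proof.
move=> u0 v0 uv eps0 Yi Ye.
pose X z := rv P (measurable_scale_rv (axis_factor u v z) (Y z)).
have c0 z : 0 < axis_factor u v z by case: z => -[|?] [|?] /=.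
have Xe z : exponential_law (axis_factor u v z)^-1 (distribution P (X z)).
  exact: (exponential_law_scale (c0 z)).
have SX : stationary_weights u^-1 v^-1 X.
  split.
  - exact: (mutually_independent_scale (X := Y) (c := axis_factor u v)).
  - by move=> i; exact: (Xe (i.+1, 0)%N).
  - by move=> j; exact: (Xe (0, j.+1)%N).
  - by move=> i j; have := Xe (i.+1, j.+1); rewrite /= invr1.
have X00 : exponential_law 1 (distribution P (X (0, 0)%N)).
  by have := Xe (0, 0)%N; rewrite /= invr1.
have := lpp_stationary_concentration a b _ _ uv eps0 SX X00.
rewrite !invr_gt0 !invrK => /(_ u0 v0).
apply: exponentially_likely_imply => k w h Yge0; apply: h => z /=.
by rewrite mulr_ge0 // ltW.
Qed.

End Stationary.

(** * Last-passage times at grid points *)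

Section GridPoints.
Context (R : realType) (d : measure_display) (Omega : measurableType d).
Variables (P : probability Omega R) (Y : nat * nat -> {RV P >-> R}).
Hypothesis Yindep : mutually_independent Y.
Hypothesis Yexp : forall z, exponential_law 1 (distribution P (Y z)).

(* [(p + q) / p + h] and [1 + (q / p + h)^-1] are conjugate exponents, hence the
   axis multipliers of a stationary model; at [h = 0] they are characteristic
   for the direction [(p ^+ 2, q ^+ 2)], and the stationary growth rate
   [p ^+ 2 * u + q ^+ 2 * v] is minimal there, equal to [(p + q) ^+ 2]. *)
Lemma growth_rate_perturbation (p q h : R) : 0 < p -> 0 < q -> 0 < h ->
  p ^+ 2 * ((p + q) / p + h) + q ^+ 2 * (1 + (q / p + h)^-1) <=
  (p + q) ^+ 2 + h ^+ 2 * (p ^+ 3 / q).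
Proof.
move=> p0 q0 h0; have D0 : 0 < q + p * h by rewrite addr_gt0 // mulr_gt0.
have -> : (q / p + h)^-1 = p / (q + p * h).
  by field; rewrite !gt_eqF.
rewrite -subr_ge0.
have -> : (p + q) ^+ 2 + h ^+ 2 * (p ^+ 3 / q) -
    (p ^+ 2 * ((p + q) / p + h) + q ^+ 2 * (1 + p / (q + p * h))) =
    h ^+ 3 * p ^+ 4 / (q * (q + p * h)).
  by field; rewrite !gt_eqF.
by rewrite divr_ge0 ?mulr_ge0 ?exprn_ge0 // ltW.
Qed.

(** [W] and [W'] are the passage times at the characteristic and at the perturbed multipliers.
    Comparing them bounds [h * A] by [k * (h ^+ 2 * (p ^+ 3 / q) + 2 * e)], and lowering the
    multiplier from [(p + q) / p] to 1 costs [q / p * A]. *)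
Lemma subgradient_lower_bound (p q h e k W W' G A : R) :
  0 < p -> 0 < q -> 0 < h -> 0 <= k ->
  W + (1 - (p + q) / p) * A <= G ->
  W + ((p + q) / p + h - (p + q) / p) * A <= W' ->
  k * ((p + q) ^+ 2 - e) <= W ->
  W' <= k * (p ^+ 2 * ((p + q) / p + h) + q ^+ 2 * (1 + (q / p + h)^-1) + e) ->
  k * ((p + q) ^+ 2 - (e + h * p ^+ 2 + 2 * e * (q / (p * h)))) <= G.
Proof.
move=> p0 q0 h0 k0.
have -> : 1 - (p + q) / p = - (q / p) by field; rewrite gt_eqF.
rewrite [_ + h]addrC addrK => WG WW' We W'e.
have L := growth_rate_perturbation p0 q0 h0.
have hA : h * A <= k * (h ^+ 2 * (p ^+ 3 / q) + 2 * e).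
  have := ler_wpM2l k0 L; lra.
have : (q / (p * h)) * (h * A) <=
    (q / (p * h)) * (k * (h ^+ 2 * (p ^+ 3 / q) + 2 * e)).
  by rewrite ler_wpM2l // divr_ge0 // ?mulr_ge0 // ltW.
have -> : q / (p * h) * (h * A) = q / p * A by field; rewrite !gt_eqF.
have -> : q / (p * h) * (k * (h ^+ 2 * (p ^+ 3 / q) + 2 * e)) =
    k * (h * p ^+ 2 + 2 * e * (q / (p * h))) by field; rewrite !gt_eqF.
by move=> qA; nra.
Qed.

Let G (k a b : nat) w := lpp (Y^~ w) (k * a)%N (k * b)%N.

(** The characteristic multipliers are at least 1, so scaling only raises passage times, and their
    growth rate is exactly [g_pp]. They are finite because [a] and [b] are positive. *)
Lemma lpp_grid_upper (a b : nat) (eps : R) :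
  0 < eps -> (0 < a)%N -> (0 < b)%N ->
  exponentially_likely P (fun k w => (forall z, 0 <= Y z w) ->
    G k a b w <= k%:R * (g_pp (a%:R, b%:R) + eps)).
Proof.
move=> eps0 a0 b0; pose p : R := Num.sqrt a%:R; pose q : R := Num.sqrt b%:R.
have p0 : 0 < p by rewrite sqrtr_gt0 ltr0n.
have q0 : 0 < q by rewrite sqrtr_gt0 ltr0n.
have pq0 : 0 < p + q by exact: addr_gt0.
have aE : a%:R = p ^+ 2 by rewrite sqr_sqrtr // ler0n.
have bE : b%:R = q ^+ 2 by rewrite sqr_sqrtr // ler0n.
have u1 : 1 <= (p + q) / p by rewrite ler_pdivlMr // mul1r lerDl ltW.
have v1 : 1 <= (p + q) / q by rewrite ler_pdivlMr // mul1r lerDr ltW.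
have uv : ((p + q) / p)^-1 + ((p + q) / q)^-1 = 1 by field; rewrite !gt_eqF.
have := lpp_scale_axes_concentration a b (divr_gt0 pq0 p0) (divr_gt0 pq0 q0) uv
  eps0 Yindep Yexp.
apply: exponentially_likely_imply => k w h Y0.
apply: (le_trans (lpp_scale_axes_ge _ _ Y0 u1 v1)).
have := h Y0; rewrite ler_norml => /andP[_].
rewrite lerBlDr => /le_trans; apply.
have -> : a%:R * ((p + q) / p) + b%:R * ((p + q) / q) = g_pp (a%:R, b%:R).
  by rewrite /g_pp /= -/p -/q {1}aE {1}bE; field; rewrite !gt_eqF.
by rewrite mulrDr addrC [eps * _]mulrC.
Qed.

Lemma lpp_grid_lower_axis (a b : nat) (eps : R) :
  0 < eps -> a = 0%N \/ b = 0%N ->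
  exponentially_likely P (fun k w => (forall z, 0 <= Y z w) ->
    k%:R * (g_pp (a%:R, b%:R) - eps) <= G k a b w).
Proof.
move=> eps0 ab0.
(* On an axis the only path is the axis itself. Multipliers 2 and 2 double its weights away from the
   origin, so half of the concentrated value is the claim. *)
have uv : 2^-1 + 2^-1 = 1 :> R by lra.
have := lpp_scale_axes_concentration a b (ltr0Sn R 1) (ltr0Sn R 1) uv
  eps0 Yindep Yexp.
apply: exponentially_likely_imply => k w h Y0.
have := h Y0; rewrite ler_norml => /andP[+ _]; rewrite /G.
have k0 : 0 <= eps * k%:R by rewrite mulr_ge0 // ltW.
have Y00 := Y0 (0, 0)%N.
case: ab0 => ->; rewrite muln0 /g_pp /= sqrtr0.
- rewrite add0r sqr_sqrtr ?ler0n // !lpp0j /scale_axes /= -mulr_sumr.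
  by set S := \sum_(_ < _) _; lra.
- rewrite addr0 sqr_sqrtr ?ler0n // !lppi0 /scale_axes /= -mulr_sumr.
  by set S := \sum_(_ < _) _; lra.
Qed.

Lemma lpp_grid_lower (a b : nat) (eps : R) : 0 < eps ->
  exponentially_likely P (fun k w => (forall z, 0 <= Y z w) ->
    k%:R * (g_pp (a%:R, b%:R) - eps) <= G k a b w).
Proof.
move=> eps0.
have [a0|a0] := posnP a; first by apply: lpp_grid_lower_axis => //; left.
have [b0|b0] := posnP b; first by apply: lpp_grid_lower_axis => //; right.
pose p : R := Num.sqrt a%:R; pose q : R := Num.sqrt b%:R.
have p0 : 0 < p by rewrite sqrtr_gt0 ltr0n.
have q0 : 0 < q by rewrite sqrtr_gt0 ltr0n.
have pq0 : 0 < p + q by exact: addr_gt0.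
have aE : a%:R = p ^+ 2 by rewrite sqr_sqrtr // ler0n.
have bE : b%:R = q ^+ 2 by rewrite sqr_sqrtr // ler0n.
(* With these values [h * p ^+ 2] is [eps / 4], and [e] below makes the other two error terms of
   [subgradient_lower_bound] at most [eps / 4] each; likewise for [h'] with [p] and [q]
   exchanged. *)
pose h := eps / (4 * p ^+ 2); pose h' := eps / (4 * q ^+ 2).
have h0 : 0 < h by rewrite divr_gt0 // mulr_gt0 // exprn_gt0.
have h'0 : 0 < h' by rewrite divr_gt0 // mulr_gt0 // exprn_gt0.
pose e := Num.min (eps / 4) (Num.min (eps * (p * h) / (8 * q))
  (eps * (q * h') / (8 * p))).
have e0 : 0 < e.
  by rewrite !lt_min; apply/and3P; split;
    repeat (apply: divr_gt0 => // || apply: mulr_gt0 => //).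
have e1 : e <= eps / 4 by rewrite ge_min lexx.
have small (x y g : R) : 0 < x -> 0 < y -> 0 < g -> g = eps / (4 * x ^+ 2) ->
    e <= eps * (x * g) / (8 * y) ->
    e + g * x ^+ 2 + 2 * e * (y / (x * g)) <= eps.
  move=> x0 y0 g0 gE ee.
  have -> : g * x ^+ 2 = eps / 4 by rewrite gE; field; rewrite gt_eqF.
  have : e * (y / (x * g)) <= eps * (x * g) / (8 * y) * (y / (x * g)).
    by rewrite ler_pM2r // divr_gt0 // mulr_gt0.
  have -> : eps * (x * g) / (8 * y) * (y / (x * g)) = eps / 8.
    by field; rewrite !gt_eqF.
  by lra.
have s1 : e + h * p ^+ 2 + 2 * e * (q / (p * h)) <= eps.
  by apply: small => //; rewrite !ge_min lexx !orbT.
have s2 : e + h' * q ^+ 2 + 2 * e * (p / (q * h')) <= eps.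
  by apply: small => //; rewrite !ge_min lexx !orbT.
have rate_gt0 (x y g : R) : 0 < x -> 0 < y -> 0 < g ->
    [/\ 0 < (x + y) / x + g, 0 < 1 + (y / x + g)^-1 &
      ((x + y) / x + g)^-1 + (1 + (y / x + g)^-1)^-1 = 1].
  move=> x0 y0 g0; have yx : 0 < y / x + g by rewrite addr_gt0 // divr_gt0.
  have -> : (x + y) / x + g = 1 + (y / x + g) by field; rewrite gt_eqF.
  have D0 : 0 < 1 + (y / x + g) by rewrite addr_gt0.
  have D1 : 0 < 1 + (y / x + g)^-1 by rewrite addr_gt0 // invr_gt0.
  split => //; set z := y / x + g in yx D0 D1 *.
  by field; rewrite !gt_eqF //; rewrite addrC.
have [u'0 v'0 uv'] := rate_gt0 p q h p0 q0 h0.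
have [v''0 u''0 uv''] := rate_gt0 q p h' q0 p0 h'0.
rewrite addrC in uv''.
have uv : ((p + q) / p)^-1 + ((p + q) / q)^-1 = 1 by field; rewrite !gt_eqF.
have C := lpp_scale_axes_concentration a b (divr_gt0 pq0 p0) (divr_gt0 pq0 q0)
  uv e0 Yindep Yexp.
have C' := lpp_scale_axes_concentration a b u'0 v'0 uv' e0 Yindep Yexp.
have C'' := lpp_scale_axes_concentration a b u''0 v''0 uv'' e0 Yindep Yexp.
apply: exponentially_likely_imply (exponentially_likely_and C
  (exponentially_likely_and C' C'')) => k w [c [c' c'']] Y0.
have k0 : 0 <= k%:R :> R by rewrite ler0n.
have gE : g_pp (a%:R, b%:R) = (p + q) ^+ 2 by [].
have [A A0 sub] := lpp_scale_axes_subgradient ((p + q) / p) ((p + q) / q)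
  (k * a) (k * b) Y0.
have {c} cW : k%:R * ((p + q) ^+ 2 - e) <= lpp (scale_axes ((p + q) / p)
    ((p + q) / q) (Y^~ w)) (k * a)%N (k * b)%N.
  have := c Y0; rewrite ler_norml => /andP[+ _].
  have -> : a%:R * ((p + q) / p) + b%:R * ((p + q) / q) = (p + q) ^+ 2.
    by rewrite {1}aE {1}bE; field; rewrite !gt_eqF.
  by rewrite lerBrDl mulrBr [k%:R * e]mulrC.
have /ler_normlP[_ cW'] := c' Y0; rewrite lerBlDl aE bE in cW'.
have /ler_normlP[_ cW''] := c'' Y0; rewrite lerBlDl aE bE in cW''.
(* If the path leaves along the horizontal axis, the comparison model raises [u] by [h]; otherwise
   it raises [v] by [h'], with [p] and [q] exchanged. *)
case: sub => sub.
- have B := @subgradient_lower_bound p q h e k%:R _ _ _ A p0 q0 h0 k0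
    (sub 1 1) (sub _ (1 + (q / p + h)^-1)) cW.
  rewrite scale_axes11 in B; rewrite /G gE; apply: le_trans (B _).
    by rewrite ler_wpM2l // lerD2l lerN2.
  by rewrite mulrDr [k%:R * e]mulrC.
- have cW2 : k%:R * ((q + p) ^+ 2 - e) <= lpp (scale_axes ((p + q) / p)
    ((p + q) / q) (Y^~ w)) (k * a)%N (k * b)%N by rewrite [q + p]addrC.
  have B := @subgradient_lower_bound q p h' e k%:R _ _ _ A q0 p0 h'0 k0.
  rewrite [q + p]addrC in B.
  have {}B := B _ _ _ (sub 1 1) (sub (1 + (p / q + h')^-1) _) cW.
  rewrite scale_axes11 in B; rewrite /G gE; apply: le_trans (B _).
    by rewrite ler_wpM2l // lerD2l lerN2.
  rewrite [q + p]addrC in cW''.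
  by rewrite mulrDr [k%:R * e]mulrC addrC [q ^+ 2 * _ + _]addrC addrC.
Qed.

End GridPoints.

(** * From exponential bounds to a random threshold *)

Section RandomThreshold.
Context (R : realType) (d : measure_display) (Omega : measurableType d).
Variable P : probability Omega R.

Lemma exponentially_small_limsup (B : nat -> set Omega) :
  (forall k, measurable (B k)) -> exponentially_small P B ->
  P (lim_sup_set B) = 0%E.
Proof.
move=> mB [C [q [C0 q0 q1 PB]]]; apply: lim_sup_set_cvg0 => //.
apply: (@le_lt_trans _ _ (C / (1 - q))%:E); last exact: ltry.
apply: lime_le; first exact: is_cvg_nneseries.
apply: nearW => n.
apply: (@le_trans _ _ (\sum_(0 <= k < n) (C * q ^+ k)%:E)%E).
  by apply: lee_sum => k _; exact: PB.
rewrite sumEFin lee_fin -mulr_sumr ler_wpM2l //.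
rewrite -[leRHS]mul1r ler_pdivlMr ?subr_gt0 // big_mkord.
have := subrX1 q n; have : 0 <= q ^+ n by rewrite exprn_ge0.
by set S := \sum_(_ < _) _ => ? ?; lra.
Qed.

(** [T] is the supremum of [c], and of [c * k.+1] over the [k] for which [B k] occurs. By
    Borel-Cantelli almost surely only finitely many [B k] occur, which makes [T] finite, and
    [T <= t < c * k.+1] excludes [B k]. *)
Lemma random_threshold (Q : nat -> Omega -> Prop) (c : R) : 0 < c ->
  exponentially_likely P Q ->
  exists T : {RV P >-> \bar R}, {ae P, forall w, T w \is a fin_num} /\
    forall w (t : R), (T w <= t%:E)%E ->
      c <= t /\ forall k : nat, t < c * k.+1%:R -> Q k w.
Proof.
move=> c0 [B [mB sB BQ]].
pose f (k : nat) (w : Omega) : \bar R := (c + c * k%:R * \1_(B k) w)%:E.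
have mf k : measurable_fun setT (f k).
  apply/measurable_EFinP; apply: measurable_funD => //.
  by apply: measurable_funM.
have fub w T : (forall k, (f k w <= T)%E) -> (esups (f^~ w) 0%N <= T)%E.
  by move=> fT; apply: ge_ereal_sup => _ [k _ <-].
have flb w k : (f k w <= esups (f^~ w) 0%N)%E.
  by apply: ereal_sup_ubound; exists k.
exists (rv P (measurable_fun_esups mf 0)); split.
  exists (lim_sup_set B); split.
  - apply: bigcapT_measurable => n; apply: bigcup_measurable => k _; exact: mB.
  - exact: exponentially_small_limsup.
  move=> w /= nfin n _; apply: contrapT => Bn; apply: nfin.
  have Bk k : (n <= k)%N -> \1_(B k) w = 0 :> R.
    move=> nk; rewrite indicE memNset // => Bkw; apply: Bn.
    by exists k.
  apply/fin_numP; split.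
    rewrite gt_eqF //; apply: lt_le_trans (flb w 0%N); exact: ltNyr.
  rewrite lt_eqF //; apply: le_lt_trans (ltry (c + c * n%:R)).
  apply: fub => k; rewrite lee_fin lerD2l -mulrA ler_pM2l //.
  have [nk|kn] := leqP n k; first by rewrite Bk // mulr0 ler0n.
  apply: (@le_trans _ _ k%:R); last by rewrite ler_nat ltnW.
  by rewrite ler_piMr ?ler0n // indicE lern1 leq_b1.
move=> w t /= Tt; split.
  have := le_trans (flb w 0%N) Tt; rewrite lee_fin; apply: le_trans.
  by rewrite mulr0 mul0r addr0.
move=> k tk; apply: BQ => Bk.
have := le_trans (flb w k) Tt; rewrite lee_fin indicE mem_set // mulr1.
by rewrite leNgt -[X in X + _]mulr1 -mulrDr nat1r tk.
Qed.

End RandomThreshold.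

(** * From the grid to the quadrant *)

Section Interpolation.
Variable R : realType.

Lemma sqrtrD_le (x y : R) : 0 <= x -> 0 <= y ->
  Num.sqrt (x + y) <= Num.sqrt x + Num.sqrt y.
Proof.
move=> x0 y0; have sx := sqrtr_ge0 x; have sy := sqrtr_ge0 y.
rewrite -(@ler_pXn2r _ 2) ?nnegrE ?addr_ge0 ?sqrtr_ge0 //.
rewrite sqr_sqrtr ?addr_ge0 // sqrrD !sqr_sqrtr //.
by rewrite addrAC lerDl mulrn_wge0 // mulr_ge0.
Qed.

Lemma g_pp_scale (s : R) (z : R * R) : 0 <= s ->
  g_pp (s * z.1, s * z.2) = s * g_pp z.
Proof.
by move=> s0; rewrite /g_pp /= !sqrtrM // -mulrDr exprMn sqr_sqrtr.
Qed.

Lemma g_pp_ge (z : R * R) : 0 <= z.1 -> 0 <= z.2 ->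
  z.1 <= g_pp z /\ z.2 <= g_pp z.
Proof.
move=> z1 z2; rewrite /g_pp sqrrD !sqr_sqrtr //.
have : 0 <= Num.sqrt z.1 * Num.sqrt z.2 *+ 2 by rewrite mulrn_wge0 // mulr_ge0 // sqrtr_ge0.
by move=> h; split; lra.
Qed.

(** Here [S] and [U] are the sums of square roots of the coordinates at a point and at its grid
    neighbour, and [s] is the square root of the spacing: rounding moves each root by at most [s].
    The cross term satisfies [S * s <= d * t], so the total error is at most [9 * d * t]. *)
Lemma lower_margin (d eps t S s U : R) : 0 < d -> 20 * d <= eps -> eps <= 1 ->
  0 <= t -> 0 <= S -> 0 <= s -> 0 <= U -> s ^+ 2 <= d ^+ 2 * t ->
  S ^+ 2 <= t * (1 - eps) -> U <= S + 2 * s -> U ^+ 2 + s ^+ 2 <= t.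
Proof.
move=> d0 deps eps1 t0 S0 s0 U0 sd St US.
have U2 : U ^+ 2 <= (S + 2 * s) ^+ 2 by rewrite ler_pXn2r // nnegrE; lra.
have et : 0 <= t * eps by rewrite mulr_ge0 //; lra.
have S2t : d ^+ 2 * S ^+ 2 <= d ^+ 2 * t by rewrite ler_pM2l ?exprn_gt0 //; lra.
have Ss : S * s <= d * t.
  have : 0 <= (d * S - s) ^+ 2 by exact: sqr_ge0.
  move=> h; rewrite -(ler_pM2l d0); lra.
have dt : 20 * (d * t) <= t * eps by nra.
have ddt : d ^+ 2 * t <= d * t by nra.
lra.
Qed.

(** The counterpart for rounding down: now [2 * U * s <= 3 * d * t], and the total error is at most
    [11 * d * t]. *)
Lemma upper_margin (d eps t S s U : R) : 0 < d -> 20 * d <= eps -> d <= 1 ->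
  0 < t -> 0 <= S -> 0 <= s -> 0 <= U -> s ^+ 2 <= d ^+ 2 * t ->
  U ^+ 2 <= t + s ^+ 2 -> S <= U + 2 * s -> S ^+ 2 < t * (1 + eps).
Proof.
move=> d0 deps d1 t0 S0 s0 U0 sd Ut SU.
have S2 : S ^+ 2 <= (U + 2 * s) ^+ 2 by rewrite ler_pXn2r // nnegrE; lra.
have dt0 : 0 < d * t by exact: mulr_gt0.
have ddt : d ^+ 2 * t <= d * t by nra.
have dd1 : d ^+ 2 <= 1 by nra.
have ddt1 : d ^+ 2 * t <= t by nra.
have U2t : d ^+ 2 * U ^+ 2 <= d ^+ 2 * (2 * t).
  by rewrite ler_pM2l ?exprn_gt0 //; lra.
have Us : 2 * (U * s) <= 3 * (d * t).
  have : 0 <= (d * U - s) ^+ 2 by exact: sqr_ge0.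
  move=> h; rewrite -(ler_pM2l d0); lra.
have dt : 20 * (d * t) <= t * eps by nra.
lra.
Qed.

Lemma floor_site (z : R * R) : 0 <= z.1 -> 0 <= z.2 ->
  (Num.floor z.1, Num.floor z.2) = site (Num.truncn z.1, Num.truncn z.2).
Proof.
by move=> z1 z2; rewrite /site /= !truncn_floor z1 z2 !gez0_abs ?floor_ge0.
Qed.

(** [k] is the grid spacing, comparable to [d ^+ 2 * t]. Since [t / k < 2 / d ^+ 2], the bound on
    [n] makes [n] spacings reach [t * (1 + eps)]; the index [n.+1] leaves room for rounding up. *)
Variables (a : nat * nat -> R) (d eps t : R) (k n : nat).
Hypotheses (a0 : forall z, 0 <= a z) (eps0 : 0 < eps) (d0 : 0 < d).
Hypotheses (d1 : d <= 1) (deps : 20 * d <= eps) (k0 : (0 < k)%N).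
Hypotheses (kt : k%:R <= d ^+ 2 * t) (tk : d ^+ 2 * t < 2 * k%:R).
Hypothesis n_large : 2 * (1 + eps) / d ^+ 2 <= n%:R.
Hypothesis grid_lower : forall i j, (i <= n.+1)%N -> (j <= n.+1)%N ->
  k%:R * (g_pp (i%:R, j%:R) - 1) <= lpp a (k * i)%N (k * j)%N.
Hypothesis grid_upper : forall i j, (0 < i <= n.+1)%N -> (0 < j <= n.+1)%N ->
  lpp a (k * i)%N (k * j)%N <= k%:R * (g_pp (i%:R, j%:R) + 1).

Let kR0 : 0 < k%:R :> R. Proof. by rewrite ltr0n. Qed.
Let dd0 : 0 < d ^+ 2. Proof. by rewrite exprn_gt0. Qed.

Let t0 : 0 < t.
Proof. by rewrite -(pmulr_rgt0 _ dd0); exact: lt_le_trans kt. Qed.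

Let sqrtk2 : Num.sqrt (k%:R : R) ^+ 2 = k%:R.
Proof. by rewrite sqr_sqrtr // ltW. Qed.

Let sqrt_grid i : Num.sqrt ((k * i)%:R : R) = Num.sqrt k%:R * Num.sqrt i%:R.
Proof. by rewrite natrM sqrtrM // ltW. Qed.

Let g_pp_grid i j : k%:R * g_pp (i%:R, j%:R) =
  (Num.sqrt ((k * i)%:R : R) + Num.sqrt (k * j)%:R) ^+ 2.
Proof. by rewrite !sqrt_grid -mulrDr exprMn sqrtk2. Qed.

Let index (x : R) := Num.truncn (x / k%:R).

Let index_le x : 0 <= x -> (k * index x)%:R <= x.
Proof.
by move=> x0; rewrite natrM mulrC -ler_pdivlMr // truncn_le divr_ge0 // ltW.
Qed.

Let index_gt x : x < (k * (index x).+1)%:R.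
Proof. by rewrite natrM mulrC -ltr_pdivrMr // truncnS_gt. Qed.

Let index_bound x : 0 <= x -> x <= t * (1 + eps) -> (index x <= n)%N.
Proof.
move=> x0 xt; rewrite truncn_le_nat -natr1 ltr_pdivrMr //.
apply: (le_lt_trans xt); rewrite -(ltr_pM2l dd0).
have h : 2 * (1 + eps) <= n%:R * d ^+ 2 by rewrite -ler_pdivrMr.
have n0 : 0 <= n%:R :> R by rewrite ler0n.
have e1 : 0 < 1 + eps by rewrite addr_gt0.
have h1 : d ^+ 2 * t * (1 + eps) < 2 * k%:R * (1 + eps) by rewrite ltr_pM2r.
have h2 : 2 * (1 + eps) * k%:R <= n%:R * d ^+ 2 * k%:R by rewrite ler_pM2r.
have h3 : 0 < d ^+ 2 * k%:R by exact: mulr_gt0.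
lra.
Qed.

Let sqrt_index_succ x : 0 <= x ->
  Num.sqrt ((k * (index x).+1)%:R : R) <= Num.sqrt x + Num.sqrt k%:R.
Proof.
move=> x0; apply: le_trans (sqrtrD_le x0 (ltW kR0)).
by rewrite ler_wsqrtr // mulnS natrD addrC lerD2r index_le.
Qed.

Let sqrt_le_index x : 0 <= x ->
  Num.sqrt x <= Num.sqrt ((k * index x)%:R : R) + Num.sqrt k%:R.
Proof.
move=> x0; apply: le_trans (sqrtrD_le (ler0n _ _) (ltW kR0)).
by rewrite ler_wsqrtr // -natrD addnC -mulnS ltW.
Qed.

(** Round up to the grid: monotonicity bounds the passage time by that of the upper corner, whose
    indices are positive as [grid_upper] demands. *)
Lemma lpp_floor_le (z : R * R) : eps <= 1 -> 0 <= z.1 -> 0 <= z.2 ->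
  g_pp z <= t * (1 - eps) -> lpp a (Num.truncn z.1) (Num.truncn z.2) <= t.
Proof.
move=> eps1 z1 z2 gz; have [g1 g2] := g_pp_ge z1 z2.
have te : t * (1 - eps) <= t * (1 + eps).
  by rewrite ler_pM2l // lerD2l ltW // gtrN.
have b1 := index_bound z1 (le_trans g1 (le_trans gz te)).
have b2 := index_bound z2 (le_trans g2 (le_trans gz te)).
have le_grid x : 0 <= x -> (Num.truncn x <= k * (index x).+1)%N.
  by move=> x0; rewrite ltnW // truncn_lt_nat.
apply: (le_trans (lpp_nondecreasing a0 (le_grid _ z1) (le_grid _ z2))).
apply: (le_trans (grid_upper _ _)); rewrite ?ltnS //.
rewrite mulrDr mulr1 g_pp_grid -[in X in _ + X]sqrtk2.
have U0 i j : 0 <= Num.sqrt ((k * i)%:R : R) + Num.sqrt (k * j)%:R.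
  by rewrite addr_ge0 ?sqrtr_ge0.
have S0 : 0 <= Num.sqrt z.1 + Num.sqrt z.2 by rewrite addr_ge0 ?sqrtr_ge0.
have kd : Num.sqrt (k%:R : R) ^+ 2 <= d ^+ 2 * t by rewrite sqrtk2.
apply: (lower_margin d0 deps eps1 (ltW t0) S0 (sqrtr_ge0 _) (U0 _ _) kd gz).
by have := sqrt_index_succ z1; have := sqrt_index_succ z2; lra.
Qed.

(** A point violating the bound may lie outside the grid, so it is first contracted by [c] until
    [g_pp] equals [t * (1 + eps)]. Rounding down then stays within the grid and keeps the passage
    time at most [t], contradicting [grid_lower]. *)
Lemma g_pp_le (z : R * R) : 0 <= z.1 -> 0 <= z.2 ->
  lpp a (Num.truncn z.1) (Num.truncn z.2) <= t -> g_pp z <= t * (1 + eps).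
Proof.
move=> z1 z2 lt; rewrite leNgt; apply/negP => gz.
have te0 : 0 < t * (1 + eps) by rewrite mulr_gt0 // addr_gt0.
have g0 : 0 < g_pp z by exact: lt_trans gz.
pose c := t * (1 + eps) / g_pp z.
have c0 : 0 <= c by rewrite divr_ge0 // ltW.
have c1 : c <= 1 by rewrite ler_pdivrMr // mul1r ltW.
have gc : g_pp (c * z.1, c * z.2) = t * (1 + eps).
  by rewrite g_pp_scale // divfK // gt_eqF.
have cz1 : 0 <= c * z.1 by exact: mulr_ge0.
have cz2 : 0 <= c * z.2 by exact: mulr_ge0.
have [g1 g2] := @g_pp_ge (c * z.1, c * z.2) cz1 cz2.
rewrite gc /= in g1 g2.
have b1 := index_bound cz1 g1; have b2 := index_bound cz2 g2.
have grid_le x : 0 <= x -> (k * index (c * x) <= Num.truncn x)%N.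
  move=> x0; rewrite truncn_ge_nat //.
  by apply: (le_trans (index_le (mulr_ge0 c0 x0))); rewrite ler_piMl.
have l := le_trans (grid_lower (leqW b1) (leqW b2))
  (le_trans (lpp_nondecreasing a0 (grid_le _ z1) (grid_le _ z2)) lt).
rewrite mulrBr mulr1 g_pp_grid lerBlDr -sqrtk2 in l.
suff : g_pp (c * z.1, c * z.2) < t * (1 + eps) by rewrite gc ltxx.
have U0 i j : 0 <= Num.sqrt ((k * i)%:R : R) + Num.sqrt (k * j)%:R.
  by rewrite addr_ge0 ?sqrtr_ge0.
have S0 : 0 <= Num.sqrt (c * z.1) + Num.sqrt (c * z.2).
  by rewrite addr_ge0 ?sqrtr_ge0.
have kd : Num.sqrt (k%:R : R) ^+ 2 <= d ^+ 2 * t by rewrite sqrtk2.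
apply: (upper_margin d0 deps d1 t0 S0 (sqrtr_ge0 _) (U0 _ _) kd l).
by have := sqrt_le_index cz1; have := sqrt_le_index cz2; lra.
Qed.

End Interpolation.

(** * Simultaneous grid bounds and the shape theorem *)

Section Grid.
Context (R : realType) (d : measure_display) (Omega : measurableType d).
Variables (P : probability Omega R) (Y : nat * nat -> {RV P >-> R}).
Hypothesis Yindep : mutually_independent Y.
Hypothesis Yexp : forall z, exponential_law 1 (distribution P (Y z)).

Lemma lpp_grid_bounds (n : nat) : exponentially_likely P (fun k w =>
  [/\ forall z, 0 <= Y z w,
      forall i j, (i <= n)%N -> (j <= n)%N ->
        k%:R * (g_pp (i%:R, j%:R) - 1) <= lpp (Y^~ w) (k * i)%N (k * j)%N &
      forall i j, (0 < i <= n)%N -> (0 < j <= n)%N ->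
        lpp (Y^~ w) (k * i)%N (k * j)%N <= k%:R * (g_pp (i%:R, j%:R) + 1)]).
Proof.
have nonneg : exponentially_likely P (fun k w => forall z, 0 <= Y z w).
  exact: (exponential_rv_ge0 (l := fun=> 1)).
have bounds i j : exponentially_likely P (fun k w => (forall z, 0 <= Y z w) ->
    k%:R * (g_pp (i%:R, j%:R) - 1) <= lpp (Y^~ w) (k * i)%N (k * j)%N /\
    ((0 < i)%N -> (0 < j)%N ->
      lpp (Y^~ w) (k * i)%N (k * j)%N <= k%:R * (g_pp (i%:R, j%:R) + 1))).
  have L := lpp_grid_lower Yindep Yexp i j ltr01.
  have [i0|i0] := posnP i.
    apply: exponentially_likely_imply L => k w lb Y0.
    by split; [exact: lb|rewrite i0].
  have [j0|j0] := posnP j.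
    apply: exponentially_likely_imply L => k w lb Y0.
    by split; [exact: lb|rewrite j0].
  have U := lpp_grid_upper Yindep Yexp ltr01 i0 j0.
  apply: exponentially_likely_imply (exponentially_likely_and L U).
  by move=> k w [lb ub] Y0; split=> [|_ _]; [exact: lb|exact: ub].
have all_bounds := exponentially_likely_bounded n (fun i =>
  exponentially_likely_bounded n (bounds i)).
apply: exponentially_likely_imply (exponentially_likely_and nonneg all_bounds).
move=> k w [Y0 B]; split => // i j.
  by move=> ni nj; have [] := B i ni j nj Y0.
by move=> /andP[i0 ni] /andP[j0 nj]; have [_] := B i ni j nj Y0; apply.
Qed.

End Grid.

Lemma mutually_independent_site (R : realType) (d : measure_display)
    (Omega : measurableType d) (P : probability Omega R)
    (omega : int * int -> {RV P >-> R}) :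
  mutually_independent omega -> mutually_independent (fun z => omega (site z)).
Proof.
move=> omega_indep s B us mB.
have site_inj : injective site by move=> [i j] [k l] [-> ->].
(* Absolute values provide a left inverse of [site], used to extend the sets to all of the plane. *)
pose B' (z : int * int) := B (absz z.1, absz z.2).
have B'E z : B' (site z) = B z by case: z.
have := omega_indep [seq site z | z <- s] B'.
rewrite map_inj_uniq // big_map => /(_ us).
rewrite (eq_bigr (fun z => P (omega (site z) @^-1` B z))); last first.
  by move=> z _; rewrite B'E.
have -> : [set w | forall i, i \in [seq site z | z <- s] -> omega i w \in B' i] =
    [set w | forall z, z \in s -> omega (site z) w \in B z].
  apply/seteqP; split => w wB z.
    by move=> zs; rewrite -B'E; apply: wB; exact: map_f.
  by move=> /mapP[y ys ->]; rewrite B'E; exact: wB.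
by apply => i /mapP[z zs ->]; rewrite B'E; exact: mB.
Qed.

(* For [1 < eps] the dilation factor [1 - eps] is negative and the pointwise
   dilate leaves the quadrant, so the lower inclusion is only meaningful for
   [eps <= 1]. *)
Theorem theorem3p7 (R : realType) (d : measure_display)
    (Omega : measurableType d) (P : probability Omega R)
    (omega : int * int -> {RV P >-> R})
    (omega_indep : mutually_independent omega)
    (omega_exp : forall x : int * int, exponentially_distributed 1 (omega x))
    (eps : R) (eps_gt0 : 0 < eps) :
  exists T : {RV P >-> \bar R},
    {ae P, forall w : Omega, T w \is a fin_num} /\
    forall (w : Omega) (t : R), 0 <= t -> (T w <= t%:E)%E ->
      (eps <= 1 ->
        dilate (t * (1 - eps)) (@limit_shape R)
          `<=` growing_set (fun x => omega x w) t) /\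
      growing_set (fun x => omega x w) t
        `<=` dilate (t * (1 + eps)) (@limit_shape R).
Proof.
(* Capping at 1 ensures [dd <= 1] even when [eps] is large, while 20 is the constant of the margin
   lemmas. *)
pose e1 := Num.min eps 1; pose dd := e1 / 20.
have e10 : 0 < e1 by rewrite lt_min eps_gt0 ltr01.
have e1eps : e1 <= eps by rewrite ge_min lexx.
have e11 : e1 <= 1 by rewrite ge_min lexx orbT.
have d0 : 0 < dd by rewrite divr_gt0.
have d1 : dd <= 1 by rewrite /dd; lra.
have deps : 20 * dd <= eps by rewrite /dd; lra.
have dd0 : 0 < dd ^+ 2 by rewrite exprn_gt0.
have ddV0 : 0 < (dd ^+ 2)^-1 by rewrite invr_gt0.
pose n := (Num.truncn (2 * (1 + eps) / dd ^+ 2)).+1.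
have n_large : 2 * (1 + eps) / dd ^+ 2 <= n%:R by rewrite ltW // truncnS_gt.
have Yindep := mutually_independent_site omega_indep.
(* With threshold constant [(dd ^+ 2)^-1], the conclusion reads [1 <= dd ^+ 2 * t], and the grid
   bounds hold for every [k] with [dd ^+ 2 * t < k.+1]. The integer part of [dd ^+ 2 * t] is then a
   positive spacing of this kind. *)
have [T [Tfin HT]] := random_threshold ddV0
  (lpp_grid_bounds Yindep (fun z => omega_exp (site z)) n.+1).
exists T; split => // w t t_ge0 Tt.
have [ct {}HT] := HT w t Tt.
have dt1 : 1 <= dd ^+ 2 * t by rewrite -ler_pdivrMl // mulr1.
pose k := Num.truncn (dd ^+ 2 * t).
have k0 : (0 < k)%N by rewrite truncn_gt0.
have kt : k%:R <= dd ^+ 2 * t by rewrite truncn_le (le_trans ler01).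
have tk1 : dd ^+ 2 * t < k.+1%:R by exact: truncnS_gt.
have tk : dd ^+ 2 * t < 2 * k%:R.
  have k1 : 1 <= k%:R :> R by rewrite ler1n.
  by apply: (lt_le_trans tk1); rewrite -natr1 mulr_natl mulr2n lerD2l.
have tkc : t < (dd ^+ 2)^-1 * k.+1%:R by rewrite ltr_pdivlMl.
have [Y0 lb ub] := HT k tkc.
have t0 : 0 < t by rewrite -(pmulr_rgt0 _ dd0); exact: lt_le_trans dt1.
have passage (z : R * R) : 0 <= z.1 -> 0 <= z.2 ->
    last_passage (fun x => omega x w) (0, 0) (Num.floor z.1, Num.floor z.2) =
    lpp (fun z => omega (site z) w) (Num.truncn z.1) (Num.truncn z.2).
  by move=> z1 z2; rewrite floor_site // last_passage_lpp.
split.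
- move=> eps1 _ [z [z1 z2 gz] <-].
  have s0 : 0 <= t * (1 - eps) by rewrite mulr_ge0 // subr_ge0.
  have sz1 : 0 <= t * (1 - eps) * z.1 by exact: mulr_ge0.
  have sz2 : 0 <= t * (1 - eps) * z.2 by exact: mulr_ge0.
  split => //; rewrite passage //.
  apply: (lpp_floor_le (z := (_, _)) Y0 eps_gt0 d0 deps k0 kt tk n_large ub eps1
    sz1 sz2).
  by rewrite g_pp_scale // ler_piMr.
- move=> z [z1 z2]; rewrite passage // => lt.
  have gz := g_pp_le Y0 eps_gt0 d0 d1 deps k0 kt tk n_large lb z1 z2 lt.
  have te0 : 0 < t * (1 + eps) by rewrite mulr_gt0 // addr_gt0.
  exists ((t * (1 + eps))^-1 * z.1, (t * (1 + eps))^-1 * z.2); last first.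
    by rewrite /= !mulrA divff ?gt_eqF // !mul1r; case: (z).
  have te0' : 0 <= (t * (1 + eps))^-1 by rewrite invr_ge0 ltW.
  split; rewrite ?mulr_ge0 //=.
  by rewrite g_pp_scale // ler_pdivrMl // mulr1.
Qed.
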